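(* Let $d \ge 3$, $S \in \mathcal{S}^d(1)$ and $l \in \{1, \ldots, d\}$. Then \[ \max_{F \in \mathcal{F}_l(S)} \operatorname{vol}_{\mathbb{Z}}(F) \le \frac{2(s_d - 1)^2}{l!\,(s_{d-l+1} - 1)}. \] Moreover: (a) if $S$ is unimodularly equivalent to $S^d_1$, equality holds (for every $l$); (b) if $d \ge 4$ and $l \in \{1, d\}$, equality holds if and only if $S$ is unimodularly equivalent to $S^d_1$. In particular, for $l=d$, every $S\in\mathcal{S}^d(1)$ satisfies $\operatorname{vol}(S) \le \frac{2}{d!}(s_d-1)^2$.
   Context: The Sylvester sequence: $s_1 = 2$, $s_i = \prod_{j=1}^{i-1} s_j + 1$ for $i\ge 2$. $\mathcal{S}^d(1)$ is the set of $d$-dimensional simplices in $\mathbb{R}^d$ with vertices in $\mathbb{Z}^d$ and exactly one integral point in their interior. $\mathcal{F}_l(S)$ is the set of $l$-dimensional faces of $S$. For a rational polytope $F$ of dimension $i$, $\operatorname{vol}_{\mathbb{Z}}(F) := \operatorname{vol}_i(F)/\det(\Lambda)$, where $\Lambda = \mathbb{Z}^d \cap \operatorname{lin}\{x-y : x,y\in F\}$ and $\operatorname{vol}_i$ is $i$-dimensional Euclidean volume. $S^d_1 := \operatorname{conv}(\{0, s_1 e_1, \ldots, s_{d-1}e_{d-1}, 2(s_d-1)e_d\})$. Unimodular equivalence: existence of an affine bijection of $\mathbb{R}^d$ preserving $\mathbb{Z}^d$ mapping one polytope onto the other. *)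

(* Defs.v *)
From HB Require Import structures.
From mathcomp Require Import all_boot all_order all_algebra all_field.
From Stdlib Require Import ClassicalEpsilon.

Set Implicit Arguments.
Unset Strict Implicit.
Unset Printing Implicit Defensive.

Import Order.TTheory GRing.Theory Num.Theory.
Local Open Scope ring_scope.

(* sylv_prod n = s_1 * ... * s_n ;  s_i = s_1 * ... * s_{i-1} + 1 *)
Fixpoint sylv_prod (n : nat) : nat :=
  if n is m.+1 then (sylv_prod m * (sylv_prod m + 1))%N else 1%N.
Definition sylv (i : nat) : nat := (sylv_prod i.-1 + 1)%N.

Lemma sylv_prodE n : sylv_prod n = (\prod_(1 <= j < n.+1) sylv j)%N.
Proof.
elim: n => [|n IH]; first by rewrite big_geq.
by rewrite big_nat_recr //= -IH /sylv /=.
Qed.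

Lemma sylv1 : sylv 1 = 2%N. Proof. by []. Qed.
Lemma sylvE i : (2 <= i)%N -> sylv i = (\prod_(1 <= j < i) sylv j + 1)%N.
Proof. by case: i => [|[|i]] // _; rewrite /sylv /= -sylv_prodE. Qed.

Definition ratv (d : nat) (z : 'rV[int]_d) : 'rV[rat]_d :=
  map_mx (fun x : int => x%:~R) z.
Definition mxQ (m n : nat) (M : 'M[int]_(m, n)) : 'M[rat]_(m, n) :=
  map_mx (fun x : int => x%:~R) M.
Definition mxC (m n : nat) (M : 'M[int]_(m, n)) : 'M[algC]_(m, n) :=
  map_mx (fun x : int => x%:~R) M.

Definition edge_mx (d l : nat) (w : nat -> 'rV[int]_d) : 'M[int]_(l, d) :=
  \matrix_(j < l, k < d) (w j.+1 ord0 k - w 0%N ord0 k).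

(* z lies in lin{x - y : x, y in F} = row space of the edge matrix *)
Definition in_lin (d l : nat) (E : 'M[int]_(l, d)) (z : 'rV[int]_d) : Prop :=
  exists c : 'rV[rat]_l, ratv z = c *m mxQ E.

Definition is_lattice_basis (d l : nat) (E B : 'M[int]_(l, d)) : Prop :=
  forall z : 'rV[int]_d, in_lin E z <-> exists k : 'rV[int]_l, z = k *m B.

Definition lattice_det (d l : nat) (E : 'M[int]_(l, d)) : algC :=
  let B := epsilon (inhabits (0 : 'M[int]_(l, d))) (is_lattice_basis E) in
  sqrtC (\det (mxC B *m (mxC B)^T)).

Definition euclid_vol (d l : nat) (E : 'M[int]_(l, d)) : algC :=
  sqrtC (\det (mxC E *m (mxC E)^T)) / (l`!)%:R.

Definition volZ (d l : nat) (E : 'M[int]_(l, d)) : algC :=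
  euclid_vol E / lattice_det E.

(* a simplex is given by its vertex family v : 'I_d.+1 -> Z^d *)
Definition full_simplex_edges (d : nat) (v : 'I_d.+1 -> 'rV[int]_d)
  : 'M[int]_(d, d) := edge_mx d (fun j => v (inord j)).

Definition full_dim (d : nat) (v : 'I_d.+1 -> 'rV[int]_d) : Prop :=
  \det (mxQ (full_simplex_edges v)) != 0.

(* interior of a full-dimensional simplex: all barycentric coords > 0 *)
Definition in_interior (d : nat) (v : 'I_d.+1 -> 'rV[int]_d) (x : 'rV[rat]_d)
  : Prop :=
  exists lam : 'I_d.+1 -> rat,
    (forall i, 0 < lam i) /\ \sum_i lam i = 1 /\ x = \sum_i lam i *: ratv (v i).

Definition in_conv (d : nat) (v : 'I_d.+1 -> 'rV[int]_d) (x : 'rV[rat]_d)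
  : Prop :=
  exists lam : 'I_d.+1 -> rat,
    (forall i, 0 <= lam i) /\ \sum_i lam i = 1 /\ x = \sum_i lam i *: ratv (v i).

Definition in_Sd1 (d : nat) (v : 'I_d.+1 -> 'rV[int]_d) : Prop :=
  full_dim v /\ exists! z : 'rV[int]_d, in_interior v (ratv z).

(* l-dimensional faces: convex hulls of l+1 of the vertices (I, #|I| = l+1) *)
Definition face_vertices (d : nat) (v : 'I_d.+1 -> 'rV[int]_d)
  (I : {set 'I_d.+1}) : nat -> 'rV[int]_d :=
  fun j => v (nth ord0 (enum I) j).

Definition face_volZ (d l : nat) (v : 'I_d.+1 -> 'rV[int]_d)
  (I : {set 'I_d.+1}) : algC :=
  volZ (edge_mx l (face_vertices v I)).

Definition unimod_equiv (d : nat) (v w : 'I_d.+1 -> 'rV[int]_d) : Prop :=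
  exists (A : 'M[rat]_d) (t : 'rV[rat]_d),
    A \in unitmx /\
    (forall z : 'rV[int]_d, exists z' : 'rV[int]_d, ratv z *m A + t = ratv z') /\
    (forall z' : 'rV[int]_d, exists z : 'rV[int]_d, ratv z *m A + t = ratv z') /\
    (forall x, in_conv v x -> in_conv w (x *m A + t)) /\
    (forall y, in_conv w y -> exists x, in_conv v x /\ x *m A + t = y).

(* S^d_1 = conv(0, s_1 e_1, ..., s_{d-1} e_{d-1}, 2(s_d - 1) e_d) *)
Definition Sd1_simplex (d : nat) : 'I_d.+1 -> 'rV[int]_d :=
  fun i => \row_(k < d)
    (if (i : nat) == k.+1
     then (if (i < d)%N then (sylv i)%:Z else (2 * (sylv d - 1))%N%:Z)
     else 0).

Definition vol_bound (d l : nat) : algC :=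
  (2 * (sylv d - 1) ^ 2)%N%:R / ((l`!)%:R * (sylv (d - l + 1) - 1)%N%:R).

Arguments Sd1_simplex d i : clear implicits.

(* Main.v *)
From Stdlib Require Import ClassicalEpsilon.
From mathcomp Require Import all_boot all_order all_algebra all_field.
From mathcomp Require Import zify ring lra.
Require Import Defs.

Set Implicit Arguments.
Unset Strict Implicit.
Unset Printing Implicit Defensive.

Import Order.TTheory GRing.Theory Num.Theory.
Local Open Scope ring_scope.

(** Only l of the l + 1 vertices of a face enter its product, so the smallest coordinate can always
    be left out, by taking its vertex as base when the face contains it. Merging it into the second
    smallest preserves the product-sum inequalities and leads to an optimum at which all those for
    prefixes of length below d are equalities. Undoing the merge costs at most a factor 2, since the
    second smallest coordinate is at least half of the merged one; this is the 2 in the bound and in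
    the longest edge of [Sd1_simplex]. Equality for l = 1 fixes the last merged coordinate, and for
    l = d the product of all of them; either one determines the whole merged sequence. The case d =
    3 is different because the coordinates 1/2, 1/6, 1/6, 1/6 merge to the same optimum as 1/2, 1/3,
    1/12, 1/12. Throughout, d = n + 1. *)

(* Let beta be the barycentric coordinates of the interior lattice point, and
   write lattice vectors in barycentric coordinates.  A nonzero lattice vector u
   with beta + u > 0 would give a second interior lattice point; by pigeonhole
   such a u exists as soon as
   - the product of the beta_i over a set J of vertices exceeds the sum of the
     remaining beta_i (use the multiples of beta), or
   - the index of the edge lattice of an l-face times the product of the beta_i
     over l of its vertices exceeds 1.
   So l! vol_Z of a face is at most the inverse of such a product, and it remains
   to minimise products of l coordinates under the product-sum inequalities.
   Merging the two smallest coordinates and sorting, this is a log-majorization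
   argument against the sequence 1/s_1, ..., 1/s_(d-1), 1/(s_d - 1).
   For l = 1 or l = d (and d >= 4) equality forces beta to be extremal and, since
   the boxes then tile, forces the edge between the two vertices of smallest
   coordinate to have lattice length 2 (s_d - 1); the congruence
   s_1 ... s_(d-1) / s_i = -1 mod s_i then makes all edges at one end of it
   divisible as in S^d_1. *)

(** * The Sylvester sequence minimises products under product-sum inequalities *)

(** AM-GM: the n-th power of the mean is at least the product. The equality case is carried along
    because uniqueness of the optimum rests on it. *)
Lemma sum_ge_of_prod_ge1 n (E : nat -> rat) :
  (forall i, (i < n)%N -> 0 < E i) -> 1 <= \prod_(i < n) E i ->
  n%:R <= \sum_(i < n) E i ?= iff [forall i : 'I_n, E i == 1].
Proof.
case: n => [|n] E_gt0 prodE.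
  rewrite !big_ord0; split => //; rewrite eqxx.
  by apply/esym/forallP => -[].
have E_ge0 : {in 'I_n.+1, forall i : 'I_n.+1, 0 <= E i}.
  by move=> i _; exact/ltW/E_gt0.
have /= := leif_AGM E_ge0; rewrite card_ord.
set S := \sum_(i < n.+1) E i; set mu := S / _ => agm.
have n0 : 0 < n.+1%:R :> rat by rewrite ltr0Sn.
have mu_ge0 : 0 <= mu by rewrite divr_ge0 ?ler0n // /S sumr_ge0 // => i _; exact: E_ge0.
have mu_ge1 : 1 <= mu.
  rewrite -(@ler_pXn2r _ n.+1) ?nnegrE // expr1n.
  by rewrite (le_trans prodE) // agm.
split; first by rewrite -[leLHS]mul1r -ler_pdivlMr.
apply/eqP/forallP => [eqS|eq1].
  have mu1 : mu = 1 by rewrite /mu -eqS divff // gt_eqF.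
  have : \prod_(i < n.+1) E i == mu ^+ n.+1.
    by rewrite eq_le agm mu1 expr1n.
  rewrite (eq_leif agm) => /forall_inP eqE i.
  have {}eqE : forall j : 'I_n.+1, E j = E i.
    by move=> j; have /forall_inP/(_ i isT)/eqP := eqE j isT.
  move: eqS; rewrite /S (eq_bigr (fun=> E i)) // sumr_const card_ord.
  by rewrite -[E i *+ _]mulr_natl -[X in X = _]mulr1 => /(mulfI (lt0r_neq0 n0)) <-.
by rewrite /S (eq_bigr (fun=> 1)) ?sumr_const ?card_ord // => i _; exact/eqP/eq1.
Qed.

(* With rho = w / z, Abel summation writes the sum of w - z = z (rho - 1) with
   nonnegative coefficients on the sums of rho_i - 1 over prefixes, which are
   nonnegative by AM-GM. *)
Lemma sum_le_of_prefix_prod_le n (z w : nat -> rat) :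
  (forall i, (i < n)%N -> 0 < z i) ->
  (forall i, (i.+1 < n)%N -> z i.+1 <= z i) ->
  (forall i, (i < n)%N -> 0 < w i) ->
  (forall j, (j <= n)%N -> \prod_(i < j) z i <= \prod_(i < j) w i) ->
  \sum_(i < n) z i <= \sum_(i < n) w i ?= iff [forall i : 'I_n, z i == w i].
Proof.
move=> z0 zdec w0 zw.
pose rho i := w i / z i.
have rho0 i : (i < n)%N -> 0 < rho i by move=> lt; rewrite divr_gt0 ?z0 ?w0.
pose S j := \sum_(i < j) rho i - j%:R.
have S_ge j : (j <= n)%N -> 0 <= S j ?= iff [forall i : 'I_j, rho i == 1].
  move=> lejn.
  have prod_ge : 1 <= \prod_(i < j) rho i.
    rewrite prodf_div ler_pdivlMr ?mul1r ?zw // prodr_gt0 // => i _.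
    by rewrite z0 // (leq_trans _ lejn).
  have H := sum_ge_of_prod_ge1 (fun i lt => rho0 i (leq_trans lt lejn)) prod_ge.
  split; first by rewrite subr_ge0 H.
  by rewrite eq_sym subr_eq0 eq_sym (eq_leif H).
have abel m : (m < n)%N ->
    \sum_(i < m.+1) (w i - z i) =
      \sum_(i < m) (z i - z i.+1) * S i.+1 + z m * S m.+1.
  elim: m => [|m IH] ltm.
    rewrite !big_ord_recl !big_ord0 /S big_ord_recl big_ord0 /rho.
    by rewrite add0r !addr0 mulrBr mulr1 mulrCA divff ?mulr1 // gt_eqF ?z0.
  rewrite big_ord_recr IH ?(ltnW ltm) // [in RHS]big_ord_recr /=.
  have -> : w m.+1 - z m.+1 = z m.+1 * (S m.+2 - S m.+1).
    rewrite /S [\sum_(i < m.+2) _]big_ord_recr /= /rho.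
    rewrite [z m.+1 * _](_ : _ = z m.+1 * (w m.+1 / z m.+1) - z m.+1); last first.
      by rewrite -[m.+2%:R]natr1; ring.
    by rewrite mulrCA divff ?mulr1 // gt_eqF ?z0.
  ring.
case: n z0 zdec w0 zw rho0 S_ge abel => [|n] z0 zdec w0 zw rho0 S_ge abel.
  rewrite !big_ord0; split => //; rewrite eqxx.
  by apply/esym/forallP => -[].
have {}abel := abel n (ltnSn n); rewrite sumrB in abel.
have first_ge : 0 <= \sum_(i < n) (z i - z i.+1) * S i.+1.
  apply: sumr_ge0 => i _; apply: mulr_ge0; first by rewrite subr_ge0 zdec // ltnS.
  by rewrite S_ge // ltnS ltnW.
have last_ge : 0 <= z n * S n.+1 by rewrite mulr_ge0 ?(ltW (z0 _ _)) // S_ge.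
split; first by rewrite -subr_ge0 abel addr_ge0.
apply/eqP/forallP => [eqs|eqzw]; last by apply: eq_bigr => i _; exact/eqP.
(* All Abel terms are nonnegative with sum 0. The last one has the positive coefficient [z n], and
   its AM-GM equality alone covers every index. *)
have S0 : S n.+1 = 0.
  have : z n * S n.+1 = 0.
    by move: abel; rewrite eqs subrr; move: first_ge last_ge; lra.
  by move/eqP; rewrite mulf_eq0 gt_eqF ?z0 //= => /eqP.
have /forallP h : [forall i : 'I_n.+1, rho i == 1].
  by rewrite -(eq_leif (S_ge _ (leqnn _))) S0.
move=> i; rewrite eq_sym -subr_eq0 -(mulr1 (z i)) -(eqP (h i)) /rho.
by rewrite mulrCA divff ?mulr1 ?subrr // gt_eqF ?z0.
Qed.

Lemma sylv_prod_gt0 j : (0 < sylv_prod j)%N.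
Proof. by elim: j => //= j IH; rewrite muln_gt0 IH addn1. Qed.

(* Also equal to 1 - 1/s_1 - ... - 1/s_j. *)
Definition sylv_rem (j : nat) : rat := (sylv_prod j)%:R^-1.

Lemma sylv_rem_gt0 j : 0 < sylv_rem j.
Proof. by rewrite invr_gt0 ltr0n sylv_prod_gt0. Qed.

Lemma sylv_remS j : sylv_rem j.+1 = sylv_rem j * (sylv j.+1)%:R^-1.
Proof. by rewrite /sylv_rem /sylv /= natrM invfM. Qed.

Lemma sylv_inv j : (sylv j.+1)%:R^-1 = sylv_rem j - sylv_rem j.+1.
Proof.
have a0 : 0 < (sylv_prod j)%:R :> rat by rewrite ltr0n sylv_prod_gt0.
rewrite /sylv_rem /sylv /= natrM natrD.
by field; rewrite !gt_eqF // addr_gt0.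
Qed.

Lemma last_index (P : pred nat) m j : (m < j)%N -> P m ->
  exists2 k, (m <= k < j)%N & P k /\ forall i, (k < i < j)%N -> ~~ P i.
Proof.
elim: j => // j IH; rewrite ltnS leq_eqVlt => /orP[/eqP-> Pj|ltmj Pm].
  by exists j; [lia | split=> // i; lia].
have [Pj|nPj] := boolP (P j).
  by exists j; [lia | split=> // i; lia].
have [k /andP[lemk ltkj] [Pk nP]] := IH ltmj Pm.
exists k; first lia.
split=> // i /andP[ltki]; rewrite ltnS leq_eqVlt => /orP[/eqP-> //|ltij].
by apply: nP; rewrite ltki.
Qed.

Lemma big_ord_shift (R : Type) (idx : R) (op : R -> R -> R) k j (F : nat -> R) :
  \big[op/idx]_(i < j - k) F (i + k)%N = \big[op/idx]_(k <= i < j) F i.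
Proof. by rewrite [RHS](big_addn 0 j k xpredT F) big_mkord. Qed.

Section SylvesterExtremality.
Variable n : nat.

(* The optimum, indexed from 0, with its prefix products (over i < j) and its tail
   sums (over j <= i <= n), for j <= n + 1. *)
Definition sylv_opt (i : nat) : rat :=
  if (i < n)%N then (sylv i.+1)%:R^-1 else sylv_rem n.
Definition sylv_opt_prod (j : nat) : rat :=
  if (j <= n)%N then sylv_rem j else sylv_rem n ^+ 2.
Definition sylv_opt_tail (j : nat) : rat :=
  if (j <= n)%N then sylv_rem j else 0.

Lemma sylv_opt_gt0 i : 0 < sylv_opt i.
Proof.
by rewrite /sylv_opt; case: ifP => _; rewrite ?sylv_rem_gt0 // invr_gt0 ltr0n /sylv addn1.
Qed.

Lemma sylv_opt_prod_gt0 j : 0 < sylv_opt_prod j.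
Proof. by rewrite /sylv_opt_prod; case: ifP; rewrite ?exprn_gt0 ?sylv_rem_gt0. Qed.

Lemma sylv_opt_prodS j : (j <= n)%N ->
  sylv_opt_prod j.+1 = sylv_opt_prod j * sylv_opt j.
Proof.
move=> lejn; rewrite /sylv_opt_prod /sylv_opt lejn.
by case: ltnP => ltj; rewrite ?sylv_remS // (_ : j = n) ?expr2 //; lia.
Qed.

Lemma sylv_opt_tailS j : (j <= n)%N ->
  sylv_opt_tail j = sylv_opt j + sylv_opt_tail j.+1.
Proof.
move=> lejn; rewrite /sylv_opt_tail /sylv_opt lejn.
case: ltnP => ltj; first by rewrite sylv_inv subrK.
by rewrite (_ : j = n) ?addr0 //; lia.
Qed.

Lemma sylv_opt_sum k j : (k <= j <= n.+1)%N ->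
  \sum_(k <= i < j) sylv_opt i = sylv_opt_tail k - sylv_opt_tail j.
Proof.
case/andP; elim: j => [|j IH] lekj lejn.
  by rewrite big_geq // (_ : k = 0%N) ?subrr //; lia.
move: lekj; rewrite leq_eqVlt => /orP[/eqP->|lekj]; first by rewrite big_geq ?subrr.
rewrite big_nat_recr //= IH //; last lia.
by rewrite [sylv_opt_tail j]sylv_opt_tailS; [ring|lia].
Qed.

Lemma sylv_opt_prod_nat k j : (k <= j <= n.+1)%N ->
  sylv_opt_prod j = sylv_opt_prod k * \prod_(k <= i < j) sylv_opt i.
Proof.
case/andP; elim: j => [|j IH] lekj lejn.
  by rewrite big_geq // (_ : k = 0%N) ?mulr1 //; lia.
move: lekj; rewrite leq_eqVlt => /orP[/eqP->|lekj]; first by rewrite big_geq ?mulr1.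
by rewrite big_nat_recr //= sylv_opt_prodS // mulrA IH //; lia.
Qed.

Variable z : nat -> rat.
Let X j := \prod_(0 <= i < j) z i.
Let r j := \sum_(j <= i < n.+1) z i.

Hypothesis z_gt0 : forall i, (i <= n)%N -> 0 < z i.
Hypothesis z_dec : forall i, (i < n)%N -> z i.+1 <= z i.
Hypothesis z_prod_sum : forall j, (j <= n)%N -> X j <= r j.

Let X_gt0 j : (j <= n.+1)%N -> 0 < X j.
Proof.
move=> lej; rewrite /X big_seq_cond; apply: prodr_gt0 => i.
by rewrite andbT mem_index_iota => lti; rewrite z_gt0 //; lia.
Qed.

(* Choosing k as the last index where the prefix product of z is at least c times
   the optimal one makes majorization applicable on [k, j). *)
Lemma sylv_block_le (c : rat) m j : (m < j <= n.+1)%N -> 1 <= c ->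
  c * sylv_opt_prod m <= X m -> X j <= c * sylv_opt_prod j ->
  exists2 k, (m <= k < j)%N &
    [/\ c * sylv_opt_prod k <= X k,
        r k - r j <= sylv_opt_prod k - sylv_opt_tail j &
        r k - r j = sylv_opt_prod k - sylv_opt_tail j ->
        forall i, (k <= i < j)%N -> z i = sylv_opt i].
Proof.
move=> /andP[ltmj lejn] c_ge1 Xm Xj.
have [k /andP[lemk ltkj] [Xk Xlast]] :=
  last_index (P := fun k => c * sylv_opt_prod k <= X k) ltmj Xm.
have c0 : 0 < c by rewrite (lt_le_trans ltr01).
exists k; first by rewrite lemk.
have tailk : sylv_opt_tail k = sylv_opt_prod k.
  by rewrite /sylv_opt_tail /sylv_opt_prod (_ : (k <= n)%N = true) //; lia.
(* After [k] the prefix products stay at or below [c] times the optimal ones; dividing by [X k],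
   which is at least [c * sylv_opt_prod k], removes both the prefix and [c]. *)
have Xle i : (k <= i <= j)%N ->
    \prod_(k <= t < i) z t <= \prod_(k <= t < i) sylv_opt t.
  case/andP; rewrite leq_eqVlt => /orP[/eqP<-|ltki] leij; first by rewrite !big_geq.
  have Xi : X i <= c * sylv_opt_prod i.
    move: leij; rewrite leq_eqVlt => /orP[/eqP->//|ltij].
    by apply: ltW; rewrite ltNge; apply: Xlast; rewrite ltki.
  have Xk0 : 0 < X k by apply: X_gt0; lia.
  rewrite -(ler_pM2l Xk0).
  rewrite /X -big_cat_nat //=; last exact: ltnW.
  apply: (le_trans Xi); rewrite (sylv_opt_prod_nat (k := k)); last lia.
  rewrite mulrA ler_pM2r //; apply: prodr_gt0 => t _; exact: sylv_opt_gt0.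
have [t lt|t lt|t lt|t let_|] :=
  @sum_le_of_prefix_prod_le (j - k) (fun t => z (t + k)%N) (fun t => sylv_opt (t + k)%N).
- by apply: z_gt0; lia.
- by rewrite addSn; apply: z_dec; lia.
- exact: sylv_opt_gt0.
- by have := Xle (t + k)%N; rewrite -!big_ord_shift addnK; apply; lia.
rewrite !big_ord_shift.
rewrite sylv_opt_sum; last by rewrite (ltnW ltkj).
rewrite tailk => le_s eq_s.
have rkj : r k - r j = \sum_(k <= i < j) z i.
  by rewrite /r (big_cat_nat (n := j)) //= ?addrK // ltnW.
split=> //; rewrite rkj // => eqs i /andP[leki ltij].
move: eq_s; rewrite eqs eqxx => /esym/forallP eqz.
have lt : (i - k < j - k)%N by lia.
by have := eqz (Ordinal lt); rewrite /= subnK // => /eqP.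
Qed.

(** Descent on [j]. The block lemma with [c = 1] gives k < j with opt k <= X k <= r k <= opt k,
    where opt is [sylv_opt_prod] and the middle inequality is the product-sum hypothesis. So the
    block [k, j) is optimal, and the hypotheses hold again at [k]. *)
Lemma sylv_opt_unique j : (j <= n.+1)%N ->
  X j <= sylv_opt_prod j -> r j = sylv_opt_tail j ->
  forall i, (i < j)%N -> z i = sylv_opt i.
Proof.
elim/ltn_ind: j => -[//|j] IH lejn Xj rj.
have X0 : 1 * sylv_opt_prod 0 <= X 0.
  by rewrite /X big_geq // mul1r /sylv_opt_prod /sylv_rem /= invr1.
have Xj1 : X j.+1 <= 1 * sylv_opt_prod j.+1 by rewrite mul1r.
have [k /andP[_ ltkj] [Xk rk eqz]] := @sylv_block_le 1 0 j.+1 lejn (lexx 1) X0 Xj1.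
rewrite mul1r in Xk.
have lekn : (k <= n)%N by lia.
have Pk : sylv_opt_prod k = sylv_opt_tail k by rewrite /sylv_opt_prod /sylv_opt_tail lekn.
have Xr := z_prod_sum lekn.
have rkE : r k = sylv_opt_prod k.
  by move: rk; rewrite rj; move: Xk Xr; lra.
move=> i ltij; case: (leqP k i) => [leki|ltik].
  by apply: eqz; rewrite ?rkE ?rj // leki.
by apply: (IH k) => //; [lia | rewrite -rkE | rewrite rkE].
Qed.

(** If the prefix up to [m] is at most the optimal one, it suffices that the full product is
    minimal, which follows from uniqueness. If it exceeds it by a factor c > 1, a tail that is too
    small would give an index k with X k >= c * opt k > opt k >= r k, against the product-sum
    inequality at [k]. *)
Lemma sylv_tail_prod_ge m : (m <= n)%N ->
  sylv_opt_prod n.+1 / sylv_rem m <= X n.+1 / X m.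
Proof.
move=> lemn.
have rn : r n.+1 = 0 by rewrite /r big_geq.
have tn : sylv_opt_tail n.+1 = 0 by rewrite /sylv_opt_tail ltnn.
have Xn0 := X_gt0 (leqnn n.+1).
have pn0 := sylv_opt_prod_gt0 n.+1.
have pm : sylv_opt_prod m = sylv_rem m by rewrite /sylv_opt_prod lemn.
have vm0 := sylv_rem_gt0 m.
have Xm0 : 0 < X m by apply: X_gt0; lia.
have [le_m|lt_m] := leP (X m) (sylv_rem m).
  have Xn : sylv_opt_prod n.+1 <= X n.+1.
    rewrite leNgt; apply/negP => ltX.
    have eqz := sylv_opt_unique (leqnn _) (ltW ltX) (etrans rn (esym tn)).
    move: ltX; rewrite (sylv_opt_prod_nat (k := 0)) ?leqnn // {1}/sylv_opt_prod /sylv_rem /= invr1 mul1r.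
    rewrite /X !big_mkord [ltRHS](eq_bigr (fun i : 'I_n.+1 => z i)) ?ltxx // => i _.
    by rewrite eqz.
  by rewrite ler_pM ?invr_ge0 ?(ltW pn0) ?(ltW vm0) // lef_pV2.
rewrite leNgt; apply/negP => ltX.
pose c := X m / sylv_rem m.
have c1 : 1 < c by rewrite /c ltr_pdivlMr ?mul1r.
have [||||k /andP[_ ltkn] [Xk rk _]] := @sylv_block_le c m n.+1.
- by rewrite ltnS lemn leqnn.
- exact: ltW.
- by rewrite pm /c divfK // gt_eqF.
- by move: ltX; rewrite ltr_pdivrMr // => /ltW; rewrite /c; lra.
have Xr := z_prod_sum (ltkn : (k <= n)%N).
have pk0 := sylv_opt_prod_gt0 k.
by move: rk Xk Xr pk0; rewrite rn tn !subr0; nra.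
Qed.

End SylvesterExtremality.

(** * Products of barycentric coordinates *)

Lemma prod_subseq_le (T : eqType) (F : T -> rat) (s' s : seq T) :
  (forall i, 0 <= F i) -> sorted (fun i j => F j <= F i) s -> subseq s' s ->
  \prod_(i <- s') F i <= \prod_(i <- take (size s') s) F i.
Proof.
move=> F0; elim: s s' => [|x s IH] [|y s'] //= srt.
have F_tr : transitive (fun i j => F j <= F i) by move=> a b c /[swap]; exact: le_trans.
have {}IH : subseq s' s -> \prod_(i <- s') F i <= \prod_(i <- take (size s') s) F i.
  exact: IH (path_sorted srt).
have allx := order_path_min F_tr srt.
rewrite !big_cons; case: eqP => [-> ss|_ ss].
  by rewrite ler_wpM2l ?IH.
have ys : y \in s by rewrite (mem_subseq ss) ?mem_head.
have ss' : subseq s' s by apply: subseq_trans ss; exact: subseq_cons.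
apply: ler_pM => //; last exact: IH.
- exact: prodr_ge0.
- exact: (allP allx).
Qed.

Lemma leq_sylv_prod i j : (i <= j)%N -> (sylv_prod i <= sylv_prod j)%N.
Proof.
move=> leij; rewrite -(subnK leij); elim: (j - i)%N => //= k IH.
by rewrite (leq_trans IH) // leq_pmulr // addn1.
Qed.

Section BarycentricOptimum.
Variables (n : nat) (beta : 'I_n.+2 -> rat) (p q : 'I_n.+2).
Hypotheses (n_ge2 : (2 <= n)%N) (beta_gt0 : forall i, 0 < beta i).
Hypothesis beta_sum : \sum_i beta i = 1.
Hypothesis beta_prod_sum : forall J : {set 'I_n.+2}, J != setT ->
  \prod_(i in J) beta i <= \sum_(i in ~: J) beta i.
Hypotheses (neq_pq : p != q) (beta_pq : beta p <= beta q).
Hypothesis beta_q : forall i, i != p -> beta q <= beta i.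

(* The two smallest coordinates are merged into q; the index p is dropped. *)
Definition merge (i : 'I_n.+2) : rat := if i == q then beta p + beta q else beta i.

Lemma merge_gt0 i : 0 < merge i.
Proof. by rewrite /merge; case: eqP => _; rewrite ?addr_gt0. Qed.

Lemma merge_neq i : i != q -> merge i = beta i.
Proof. by rewrite /merge => /negPf->. Qed.

Lemma merge_q : merge q = beta p + beta q.
Proof. by rewrite /merge eqxx. Qed.

Lemma beta_le_half j : 2 * beta j <= 1.
Proof.
have Jj : [set j] != setT :> {set 'I_n.+2}.
  by apply/eqP => /(congr1 (fun A : {set _} => #|A|)); rewrite cards1 cardsT card_ord.
have := beta_prod_sum Jj; rewrite big_set1.
have := beta_sum; rewrite (bigD1 j) //= (eq_bigl (fun i => i \in ~: [set j])).
  lra.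
by move=> i; rewrite !inE.
Qed.

Lemma beta_le1 j : beta j <= 1.
Proof. by have := beta_le_half j; have := beta_gt0 j; lra. Qed.

Lemma merge_le1 j : merge j <= 1.
Proof.
rewrite /merge; case: eqP => _; last exact: beta_le1.
by have := beta_le_half q; have := beta_pq; lra.
Qed.

(** If q is outside J, both sides are those of the inequality for [beta], as the merged term absorbs
    [beta p]. If J contains q and another j, the product is at most 2 [beta q] times [beta j] <=
    1/2, hence at most [beta i0]. If J is {q}, the n other coordinates are each at least [beta q],
    and n >= 2. *)
Lemma merge_prod_sum (J : {set 'I_n.+2}) i0 : p \notin J -> i0 != p -> i0 \notin J ->
  \prod_(i in J) merge i <= \sum_(i | (i != p) && (i \notin J)) merge i.
Proof.
move=> pJ i0p i0J.
have [qJ|qJ] := boolP (q \in J); last first.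
  rewrite (eq_bigr beta) => [|i iJ]; last first.
    by rewrite merge_neq //; apply: contraNneq qJ => <-.
  apply: le_trans (beta_prod_sum _) _.
    by apply: contraNneq pJ => ->; rewrite inE.
  rewrite (bigD1 p) ?inE //= (bigD1 q) ?inE ?qJ 1?eq_sym //= addrA.
  rewrite [leRHS](bigD1 q) ?qJ 1?eq_sym ?neq_pq //= merge_q lerD2l.
  rewrite le_eqVlt; apply/orP; left; apply/eqP; apply: eq_big => [i|i].
    by rewrite !inE -andbA andbCA andbA.
  by case/andP=> _ /merge_neq->.
have merge0 i : 0 <= merge i by exact: ltW (merge_gt0 i).
have sum_ge (A : {set 'I_n.+2}) : A \subset [pred i | (i != p) && (i \notin J)] ->
    \sum_(i in A) merge i <= \sum_(i | (i != p) && (i \notin J)) merge i.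
  move=> /subsetP sA; rewrite [leRHS](bigID (mem A)) /= -[leLHS]addr0 lerD //.
    2: exact: sumr_ge0.
  rewrite le_eqVlt (eq_bigl (fun i => (i != p) && (i \notin J) && (i \in A))) ?eqxx // => i.
  by case iA: (i \in A); rewrite ?andbF // andbT; have := sA i iA; rewrite inE => ->.
have [/existsP[j /andP[jq jJ]]|noj] := boolP [exists j, (j != q) && (j \in J)].
  rewrite (bigD1 q) //= (bigD1 j) ?jJ //= mulrA.
  apply: le_trans (_ : beta i0 <= _).
    set P := (X in _ * _ * X).
    have P1 : P <= 1 by apply: prodr_ile1 => i _; rewrite merge0 merge_le1.
    have P0 : 0 <= P by apply: prodr_ge0.
    rewrite merge_q merge_neq //.
    move: (beta_q i0p) (beta_le_half j) (beta_gt0 j) (beta_gt0 p) (beta_gt0 q) beta_pq.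
    move=> ? ? ? ? ? ?.
    have : (beta p + beta q) * beta j <= beta i0 by nra.
    have : 0 <= (beta p + beta q) * beta j by nra.
    nra.
  rewrite -(merge_neq (_ : i0 != q)); last by apply: contraNneq i0J => ->.
  by have := sum_ge [set i0]; rewrite big_set1; apply; apply/subsetP => i /set1P->; rewrite inE i0p.
have JE : J = [set q].
  apply/setP => i; rewrite inE; apply/idP/eqP => [iJ|->//].
  by apply: contraNeq noj => iq; apply/existsP; exists i; rewrite iq.
rewrite {1}JE big_set1.
have card_A : #|~: [set p; q]| = n.
  by have := cardsC [set p; q]; rewrite cards2 neq_pq card_ord; lia.
apply: le_trans (sum_ge (~: [set p; q]) _); last first.
  by apply/subsetP => i; rewrite JE !inE negb_or.
apply: le_trans (_ : \sum_(i in ~: [set p; q]) beta q <= _).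
  rewrite sumr_const card_A merge_q -mulr_natl.
  have : 2 <= n%:R :> rat by rewrite (ler_nat _ 2).
  have := beta_gt0 q; have := beta_pq; nra.
apply: ler_sum => i; rewrite !inE negb_or => /andP[ip iq].
by rewrite merge_neq // beta_q.
Qed.

Definition merge_order : seq 'I_n.+2 :=
  sort (fun i j => merge j <= merge i) [seq i <- enum 'I_n.+2 | i != p].
Let idx := merge_order.
Let z k := merge (nth p idx k).

Lemma merge_order_sorted : sorted (fun i j => merge j <= merge i) idx.
Proof. by apply: sort_sorted => i j; exact: le_total. Qed.

Lemma merge_order_uniq : uniq idx.
Proof. by rewrite sort_uniq filter_uniq ?enum_uniq. Qed.

Lemma mem_merge_order i : (i \in idx) = (i != p).
Proof. by rewrite mem_sort mem_filter mem_enum andbT. Qed.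

Lemma size_merge_order : size idx = n.+1.
Proof.
have /card_uniqP <- := merge_order_uniq.
by rewrite (eq_card (B := predC1 p)) ?cardC1 ?card_ord // => i; rewrite mem_merge_order.
Qed.

Lemma merge_order_prod j : (j <= n.+1)%N ->
  \prod_(0 <= i < j) z i = \prod_(i <- take j idx) merge i.
Proof.
move=> lej; rewrite [RHS](big_nth p) size_takel ?size_merge_order //.
by apply: eq_big_nat => i /andP[_ lti]; rewrite nth_take.
Qed.

Lemma merge_order_sum j : (j <= n.+1)%N ->
  \sum_(j <= i < n.+1) z i = \sum_(i <- drop j idx) merge i.
Proof.
move=> lej; rewrite [RHS](big_nth p) size_drop size_merge_order big_mkord.
rewrite -big_ord_shift; apply: eq_bigr => i _.
by rewrite nth_drop addnC.
Qed.

Lemma merge_order_prod_sum j : (j <= n)%N ->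
  \prod_(0 <= i < j) z i <= \sum_(j <= i < n.+1) z i.
Proof.
move=> lej; rewrite merge_order_prod ?merge_order_sum; try lia.
have := merge_order_uniq; rewrite -{1}(cat_take_drop j idx) cat_uniq.
case/and3P=> ut /hasPn disj ud.
have memd i : (i \in drop j idx) = (i != p) && (i \notin take j idx).
  rewrite -mem_merge_order -{2}(cat_take_drop j idx) mem_cat.
  case: (boolP (i \in drop j idx)) => [/disj|_]; rewrite ?orbF ?andbN //.
  by rewrite orbT => ->.
pose J := [set i in take j idx].
rewrite (big_uniq _ ut) (big_uniq _ ud) /=.
rewrite (eq_bigl (fun i => i \in J)) => [|i]; last by rewrite inE.
rewrite [leRHS](eq_bigl (fun i => (i != p) && (i \notin J))) => [|i]; last by rewrite !inE memd.
have ltj : (j < size idx)%N by rewrite size_merge_order.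
have : nth p idx j \in drop j idx by rewrite (drop_nth p ltj) mem_head.
rewrite memd => /andP[jp jJ].
apply: (@merge_prod_sum _ (nth p idx j)) => //; rewrite inE //.
apply/negP => /mem_take; by rewrite mem_merge_order eqxx.
Qed.

Lemma merge_order_gt0 i : (i <= n)%N -> 0 < z i.
Proof. by move=> _; exact: merge_gt0. Qed.

Lemma merge_order_dec i : (i < n)%N -> z i.+1 <= z i.
Proof.
move=> lti; have /(sortedP p) := merge_order_sorted; apply.
by rewrite size_merge_order.
Qed.

(** The complement of L is a subsequence of the sorted list, so its product is at most that of the
    prefix of the same length; divide the total product by both. *)
Lemma merge_tail_prod_le (L : {set 'I_n.+2}) : p \notin L ->
  (\prod_(0 <= i < n.+1) z i) / \prod_(0 <= i < n.+1 - #|L|) z i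
    <= \prod_(i in L) merge i.
Proof.
move=> pL.
rewrite !merge_order_prod ?leq_subr // take_oversize ?size_merge_order //.
set C := [seq i <- idx | i \notin L].
have sizeL : size [seq i <- idx | i \in L] = #|L|.
  have /card_uniqP <- : uniq [seq i <- idx | i \in L] by rewrite filter_uniq ?merge_order_uniq.
  apply: eq_card => i; rewrite mem_filter mem_merge_order andb_idr // => iL.
  by apply: contraNneq pL => <-.
have sizeC : size C = (n.+1 - #|L|)%N.
  have E := etrans (count_predC (mem L) idx) size_merge_order.
  by rewrite -sizeL /C !size_filter; apply: (canRL (addKn _)); exact: E.
have prodL : \prod_(i in L) merge i * \prod_(i <- C) merge i = \prod_(i <- idx) merge i.
  rewrite [RHS](bigID (mem L)) /= /C big_filter; congr (_ * _).
  rewrite -[RHS]big_filter [RHS]big_uniq ?filter_uniq ?merge_order_uniq //=.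
  apply: eq_bigl => i; rewrite mem_filter mem_merge_order andb_idr // => iL.
  by apply: contraNneq pL => <-.
have := @prod_subseq_le _ merge C idx (fun i => ltW (merge_gt0 i))
  merge_order_sorted (filter_subseq _ _).
rewrite sizeC => leC.
rewrite -prodL ler_pdivrMr; last by apply: prodr_gt0 => i _; exact: merge_gt0.
by rewrite ler_wpM2l // prodr_ge0 // => i _; exact: ltW (merge_gt0 i).
Qed.

Lemma merge_prod_ge (L : {set 'I_n.+2}) : p \notin L -> (0 < #|L|)%N ->
  sylv_rem n ^+ 2 / sylv_rem (n.+1 - #|L|) <= \prod_(i in L) merge i.
Proof.
move=> pL L0; apply: le_trans (merge_tail_prod_le pL).
have -> : sylv_rem n ^+ 2 = sylv_opt_prod n n.+1 by rewrite /sylv_opt_prod ltnn.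
apply: (sylv_tail_prod_ge merge_order_gt0 merge_order_dec merge_order_prod_sum); lia.
Qed.

Lemma prod_merge (L : {set 'I_n.+2}) : q \in L ->
  \prod_(i in L) merge i * beta q = (\prod_(i in L) beta i) * (beta p + beta q).
Proof.
move=> qL; rewrite (bigD1 q) //= [in RHS](bigD1 q) //= merge_q.
rewrite (eq_bigr beta) => [|i /andP[_ /merge_neq]//]; ring.
Qed.

Lemma prod_merge_le (L : {set 'I_n.+2}) : q \in L ->
  \prod_(i in L) merge i <= 2 * \prod_(i in L) beta i.
Proof.
move=> qL; rewrite -(ler_pM2r (beta_gt0 q)) prod_merge // [leRHS]mulrAC mulrC.
rewrite ler_wpM2r ?prodr_ge0 // => [i _|]; first exact: ltW.
by have := beta_pq; lra.
Qed.

(** Exchanging an element of L for q keeps the size and does not increase the product, so q may be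
    assumed in L; then passing from [beta] to [merge] at most doubles the product. *)
Theorem beta_prod_ge (L : {set 'I_n.+2}) : p \notin L -> (0 < #|L|)%N ->
  sylv_rem n ^+ 2 / (2 * sylv_rem (n.+1 - #|L|)) <= \prod_(i in L) beta i.
Proof.
move=> pL L0.
wlog qL : L pL L0 / q \in L => [IH|].
  have [/IH|qL] := boolP (q \in L); first exact.
  have [a aL] := card_gt0P L0.
  pose L' := q |: (L :\ a).
  have pL' : p \notin L' by rewrite !inE negb_or neq_pq negb_and pL orbT.
  have qLa : q \notin L :\ a by rewrite !inE negb_and qL orbT.
  have cL' : #|L'| = #|L| by rewrite cardsU1 qLa (cardsD1 a L) aL.
  have := IH L' pL'; rewrite cL' setU11 => /(_ L0 isT) /le_trans; apply.
  rewrite big_setU1 //= [leRHS](big_setD1 a) //= ler_wpM2r //.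
    by apply: prodr_ge0 => i _; exact: ltW.
  by apply: beta_q; apply: contraNneq pL => <-.
have := le_trans (merge_prod_ge pL L0) (prod_merge_le qL).
rewrite [(2 * _)^-1]invfM; lra.
Qed.

(** Equality collapses the whole chain behind [beta_prod_ge]: the factor 2 is attained, so
    [beta p = beta q], and the tail of the merged sequence is optimal. The order [s] is that of the
    vertices of [Sd1_simplex]: q plays the origin and p the end of the longest edge. *)
Theorem beta_prod_eq (L : {set 'I_n.+2}) : (3 <= n)%N -> p \notin L -> q \in L ->
  #|L| = 1%N \/ #|L| = n.+1 ->
  \prod_(i in L) beta i = sylv_rem n ^+ 2 / (2 * sylv_rem (n.+1 - #|L|)) ->
  exists s : seq 'I_n.+2,
    [/\ size s = n.+2, uniq s, nth p s 0 = q, nth p s n.+1 = p &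
     [/\ forall i, (i < n)%N -> beta (nth p s i.+1) = (sylv i.+1)%:R^-1,
      beta p = sylv_rem n / 2 & beta q = sylv_rem n / 2]].
Proof.
move=> n_ge3 pL qL cardL eqL.
have V0 := sylv_rem_gt0 n.
have le1 := prod_merge_le qL.
have le2 := merge_tail_prod_le pL.
have L0 : (0 < #|L|)%N by rewrite (cardsD1 q) qL.
have lem : (n.+1 - #|L| <= n)%N by lia.
have le3 := sylv_tail_prod_ge merge_order_gt0 merge_order_dec merge_order_prod_sum lem.
have PWn : sylv_opt_prod n n.+1 = sylv_rem n ^+ 2 by rewrite /sylv_opt_prod ltnn.
rewrite PWn in le3.
have eqL2 : 2 * \prod_(i in L) beta i = sylv_rem n ^+ 2 / sylv_rem (n.+1 - #|L|).
  by rewrite eqL invfM; field; rewrite gt_eqF ?sylv_rem_gt0.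
have eqM : \prod_(i in L) merge i = 2 * \prod_(i in L) beta i.
  by apply/eqP; rewrite eq_le le1 eqL2 (le_trans le3).
have bpq : beta p = beta q.
  have := prod_merge qL; rewrite eqM.
  have : 0 < \prod_(i in L) beta i by apply: prodr_gt0.
  nra.
have eqX : (\prod_(0 <= i < n.+1) z i) / \prod_(0 <= i < n.+1 - #|L|) z i
    = sylv_rem n ^+ 2 / sylv_rem (n.+1 - #|L|).
  by apply/eqP; rewrite eq_le le3 andbT -eqL2 -eqM.
have zE i : (i <= n)%N -> z i = sylv_opt n i.
  case: cardL eqX => ->.
    (* For one factor, the quotient is the last entry [z n]. The product-sum inequality at n then
       bounds the prefix product by [sylv_rem n], which is what uniqueness up to n requires. *)
    rewrite subSS subn0 big_nat_recr //= mulrAC divff ?mul1r; last first.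
      by rewrite gt_eqF // prodr_gt0 // => k _; exact: merge_gt0.
    rewrite expr2 mulfK ?gt_eqF // => zn.
    rewrite leq_eqVlt => /orP[/eqP->|]; first by rewrite /sylv_opt ltnn.
    have rn : \sum_(n <= k < n.+1) z k = sylv_rem n by rewrite big_nat1.
    move: i; apply: (sylv_opt_unique merge_order_gt0 merge_order_dec merge_order_prod_sum).
    - exact: leqnSn.
    - by rewrite /sylv_opt_prod leqnn -rn merge_order_prod_sum.
    - by rewrite rn /sylv_opt_tail leqnn.
  rewrite subnn [\prod_(0 <= i < 0) _]big_geq // /sylv_rem invr1 !divr1 -/(sylv_rem n) => Xn.
  move: i; apply: (sylv_opt_unique merge_order_gt0 merge_order_dec
                     merge_order_prod_sum (j := n.+1)).
  - exact: leqnn.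
  - by rewrite Xn PWn.
  - by rewrite big_geq // /sylv_opt_tail ltnn.
have ltidx i : (i <= n)%N -> (i < size idx)%N by rewrite size_merge_order.
(* If q came earlier, then 2 [beta q] would be some 1/s_i >= 1/s_n, whereas [beta q] is at most the
   last entry, [sylv_rem n.-1] / s_n <= 1/(6 s_n). The 1/6 needs n >= 3: for n = 2 the coordinates
   1/2, 1/6, 1/6, 1/6 are a counterexample. *)
have last_q : nth p idx n = q.
  apply/eqP; apply: contraT => neq_last.
  have q_idx : q \in idx by rewrite mem_merge_order eq_sym.
  have ltq : (index q idx < n.+1)%N by move: q_idx; rewrite -index_mem size_merge_order.
  have zq : z (index q idx) = 2 * beta q by rewrite /z nth_index // merge_q bpq; lra.
  have zn := zE n (leqnn n).
  have neqi : index q idx != n by apply: contraNneq neq_last => E; rewrite -[X in nth _ _ X]E nth_index.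
  have lti : (index q idx < n)%N by rewrite ltn_neqAle neqi -ltnS.
  have : beta q <= sylv_rem n.
    move: zn; rewrite /sylv_opt ltnn /z merge_neq // => <-.
    by apply: beta_q; rewrite -mem_merge_order mem_nth // ltidx.
  have n0 : (0 < n)%N by exact: leq_trans n_ge3.
  have bq : 2 * beta q = (sylv (index q idx).+1)%:R^-1.
    by rewrite -zq (zE _ (ltnW lti)) /sylv_opt lti.
  have : (sylv n)%:R^-1 <= 2 * beta q.
    rewrite bq lef_pV2 ?posrE ?ltr0n ?/sylv ?addn1 // ler_nat ltnS.
    by apply: leq_sylv_prod; rewrite /= -(ltnS _ n.-1) (prednK n0).
  have VE : sylv_rem n = sylv_rem n.-1 * (sylv n)%:R^-1.
    by case: (n) n_ge3 => // k _; rewrite sylv_remS.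
  have V6 : sylv_rem n.-1 <= 6%:R^-1.
    rewrite lef_pV2 ?posrE ?ltr0n ?sylv_prod_gt0 // ler_nat.
    by rewrite (leq_sylv_prod (i := 2)) // -(ltnS _ n.-1) (prednK n0).
  have s0 : 0 < (sylv n)%:R^-1 :> rat by rewrite invr_gt0 ltr0n /sylv addn1.
  have V6s : sylv_rem n.-1 * (sylv n)%:R^-1 <= 6%:R^-1 * (sylv n)%:R^-1.
    by rewrite ler_wpM2r // ltW.
  rewrite VE; move: s0; lra.
have bq : beta q = sylv_rem n / 2.
  have := zE n (leqnn n); rewrite /z last_q merge_q bpq /sylv_opt ltnn; lra.
exists (q :: rcons (take n idx) p).
have size_t : size (take n idx) = n by rewrite size_takel // size_merge_order.
have take_q : rcons (take n idx) q = idx.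
  by rewrite -last_q -take_nth ?ltidx // take_oversize // size_merge_order.
split=> //=.
- by rewrite size_rcons size_t.
- have := merge_order_uniq; rewrite -/idx -{1}take_q rcons_uniq => /andP[qt ut].
  rewrite mem_rcons inE negb_or eq_sym neq_pq qt rcons_uniq ut /= andbT.
  by apply/negP => /mem_take; rewrite mem_merge_order eqxx.
- by rewrite nth_rcons size_t ltnn eqxx.
split=> [i lti||//]; last by rewrite bpq.
rewrite nth_rcons size_t lti nth_take //.
have := zE i (ltnW lti); rewrite /z /sylv_opt lti merge_neq //.
apply/eqP => E.
have := nth_uniq p (ltidx i (ltnW lti)) (ltidx n (leqnn n)) merge_order_uniq.
by rewrite E last_q eqxx (ltn_eqF lti).
Qed.

End BarycentricOptimum.

(** * Lattice points in boxes *)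

Lemma mxQM m n k (A : 'M[int]_(m, n)) (B : 'M[int]_(n, k)) :
  mxQ (A *m B) = mxQ A *m mxQ B.
Proof. exact: map_mxM. Qed.

Lemma mxQ_inj m n : injective (@mxQ m n).
Proof.
move=> A B /matrixP eqAB; apply/matrixP => i j.
by have := eqAB i j; rewrite !mxE => /intr_inj.
Qed.

Lemma det_mxQ n (A : 'M[int]_n) : \det (mxQ A) = (\det A)%:~R.
Proof. exact: det_map_mx. Qed.

Lemma card_dffun_ord (I : finType) (B : I -> nat) :
  #|{dffun forall i : I, 'I_(B i)}| = (\prod_i B i)%N.
Proof.
rewrite card_dep_ffun foldrE big_image /=; apply: eq_bigr => i _.
exact: card_ord.
Qed.

Lemma absz_unit (a : int) : a \is a GRing.unit -> `|a|%N = 1%N.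
Proof. by case/orP => /eqP->. Qed.

(** In the Smith normal form the quotient by the row lattice of [K] is a product of cyclic groups of
    orders |d_i|; the digits below |d_i|, carried back by the unimodular factor [R], represent
    it. *)
Lemma coset_reps l (K : 'M[int]_l) : \det K != 0 ->
  exists (T : finType) (f : T -> 'rV[int]_l),
    #|T| = `|\det K|%N /\ forall a b k, f a - f b = k *m K -> a = b.
Proof.
move=> detK; have [L Lu [R Ru [d _ KE]]] := int_Smith_normal_form K.
set D := (\matrix_(i, j) _) in KE.
have detD : \det D = \prod_(i < l) d`_i.
  rewrite det_trig; first by apply: eq_bigr => i _; rewrite mxE eqxx.
  apply/is_trig_mxP => i j ltij; rewrite mxE (_ : (i == j :> nat) = false) //.
  exact: ltn_eqF.
have absdet : `|\det K|%N = (\prod_(i < l) absz (d`_i)%R)%N.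
  have [L1 R1] : `|\det L|%N = 1%N /\ `|\det R|%N = 1%N by rewrite !absz_unit -?unitmxE.
  rewrite KE !det_mulmx !abszM L1 R1 mul1n muln1 detD.
  by apply: (big_morph absz abszM).
exists {dffun forall i : 'I_l, 'I_(absz (d`_i)%R)}.
exists (fun g : {dffun forall i : 'I_l, 'I_(absz (d`_i)%R)} =>
  (\row_i (g i : nat)%:Z) *m R).
split; first by rewrite card_dffun_ord absdet.
move=> a b k; rewrite -mulmxBl KE mulmxA => /(can_inj (mulmxK Ru)).
rewrite mulmxA; move: (k *m L) => k' /rowP eqk.
apply/ffunP => i; apply: val_inj => /=.
have := eqk i; rewrite !mxE (bigD1 i) //= mxE eqxx mulr1n big1 ?addr0; last first.
  by move=> j ji; rewrite mxE (_ : (j == i :> nat) = false) ?mulr0n ?mulr0 //; exact: negPf.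
have := ltn_ord (a i); have := ltn_ord (b i).
move: (nat_of_ord (a i)) (nat_of_ord (b i)) => x y.
move: (k' ord0 i) (d`_i) => c e lty ltx E.
have : (`|e| %| `|x%:Z - y%:Z|)%N by rewrite E abszM dvdn_mull.
move=> /dvdnP[[|t] ht]; first by lia.
by move: ht; nia.
Qed.

Lemma common_denominator (I : finType) (b : I -> rat) : (forall i, 0 <= b i) ->
  exists2 m : nat, (0 < m)%N & exists c : I -> nat, forall i, b i = (c i)%:R / m%:R.
Proof.
move=> b0; exists (\prod_i `|denq (b i)|)%N.
  by rewrite prodn_gt0 // => i; rewrite absz_gt0 denq_neq0.
exists (fun i => `|numq (b i)| * \prod_(j | j != i) `|denq (b j)|)%N => i.
rewrite [in X in _ / X](bigD1 i) //= !natrM -mulf_div.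
rewrite divff ?mulr1; last first.
  by rewrite pnatr_eq0 -lt0n prodn_cond_gt0 // => j _; rewrite absz_gt0 denq_neq0.
rewrite -[LHS]divq_num_den !natr_absz.
by rewrite [`|denq _|]gtr0_norm ?denq_gt0 // ger0_norm ?numq_ge0.
Qed.

Lemma residue_lt (M : nat) (y : int) : (0 < M)%N -> (`|(y %% M%:Z)%Z| < M)%N.
Proof.
move=> M0; rewrite -ltz_nat gez0_abs ?modz_ge0 ?ltz_pmod //.
by rewrite -lt0n.
Qed.

Definition residue (M : nat) (M0 : (0 < M)%N) (y : int) : 'I_M := Ordinal (residue_lt y M0).

Lemma residue_eq M (M0 : (0 < M)%N) y1 y2 :
  residue M0 y1 = residue M0 y2 -> exists q, y1 - y2 = q * M%:Z.
Proof.
have M0' : (M%:Z != 0) by rewrite -lt0n.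
move=> /(congr1 val) /= E.
have {}E : (y1 %% M%:Z)%Z = (y2 %% M%:Z)%Z.
  by rewrite -[LHS]gez0_abs ?modz_ge0 // -[RHS]gez0_abs ?modz_ge0 // E.
by apply/dvdzP; rewrite -eqz_mod_dvd; apply/eqP.
Qed.

Section Box.
Variables (l : nat) (K : 'M[int]_l) (b : 'I_l -> rat).
Hypotheses (detK : \det K != 0) (b_gt0 : forall i, 0 < b i).

Let in_lattice (u : 'rV[rat]_l) := exists z : 'rV[int]_l, u *m mxQ K = ratv z.

(* Scaling by a common denominator M, the translates of the half-open box by
   coset representatives of the lattice modulo Z^l live in (Z/M)^l: they overlap
   if they are too many, and otherwise they tile. *)
Theorem box_lattice_point (i0 : 'I_l) :
  1 <= `|\det K|%N%:R * \prod_i b i ->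
  exists2 u : 'rV[rat]_l, u != 0 /\ in_lattice u &
    (forall i, `|u ord0 i| < b i) \/
    [/\ `|\det K|%N%:R * \prod_i b i = 1, u ord0 i0 = b i0 &
        forall i, i != i0 -> - b i < u ord0 i <= 0].
Proof.
move=> ge1.
have [m m0 [c bE]] := common_denominator (fun i => ltW (b_gt0 i)).
have [T [g [cardT gE]]] := coset_reps detK.
set N := `|\det K|%N in ge1 cardT *.
have N0 : (0 < N)%N by rewrite absz_gt0.
pose M := (m * N)%N; have M0 : (0 < M)%N by rewrite muln_gt0 m0.
pose B i := (c i * N)%N.
have M0r : M%:R != 0 :> rat by rewrite pnatr_eq0 -lt0n.
have M0r' : 0 < M%:R :> rat by rewrite ltr0n.
have bB i : b i = (B i)%:R / M%:R.
  by rewrite bE /B /M !natrM -mulf_div divff ?mulr1 // pnatr_eq0 -lt0n.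
(* [C] is M times the inverse of [K]. The factor N in [M] makes it integral, so that the lattice of
   the vectors u with u K integral becomes integral after scaling by M. *)
pose C : 'M[int]_l := (m%:Z * sgz (\det K)) *: \adj K.
have CK : C *m K = (M%:Z)%:M.
  rewrite /C -scalemxAl mul_adj_mx scale_scalar_mx -mulrA mulrC; congr (_%:M).
  by rewrite mulrC /M PoszM /N abszEsg.
pose box := {dffun forall i : 'I_l, 'I_(B i)}.
pose h (a : T * box) i : int := (a.2 i : nat)%:Z + (g a.1 *m C) 0 i.
pose f (a : T * box) : {ffun 'I_l -> 'I_M} := [ffun i => residue M0 (h a i)].
have latt (x : 'I_l -> nat) z a (u : 'rV[rat]_l) :
    (forall i, exists q, (x i)%:Z + (z *m C) 0 i - h a i = q * M%:Z) ->
    u = \row_i (((x i)%:R - (a.2 i : nat)%:R) / M%:R) ->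
    exists k, u *m mxQ K = ratv (g a.1 - z + k *m K).
  move=> /fin_all_exists[q qE] ->; exists (\row_i q i).
  set X := \row_i ((x i)%:Z - (a.2 i : nat)%:Z).
  have -> : (\row_i (((x i)%:R - (a.2 i : nat)%:R) / M%:R)) = M%:R^-1 *: mxQ X :> 'rV[rat]_l.
    by apply/rowP => i; rewrite !mxE mulrC rmorphB.
  rewrite -scalemxAl -mxQM.
  have -> : X = (g a.1 - z) *m C + M%:Z *: \row_i q i.
    apply/rowP => i; have := qE i; rewrite mulmxBl /h.
    move: (g a.1 *m C) (z *m C) => G Z; rewrite !mxE [q i * _]mulrC.
    by move: (_ * q i) (G 0 i) (Z 0 i) => ? ? ?; lia.
  rewrite mulmxDl -mulmxA CK mul_mx_scalar -scalemxAl -scalerDr.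
  move: (_ + _) => Y; apply/rowP => i; rewrite !mxE intrM /= mulrA.
  by rewrite -pmulrn mulVf // mul1r.
have no0 (u : 'rV[rat]_l) a a' k : u = 0 -> u *m mxQ K = ratv (g a - g a' + k *m K) -> a = a'.
  move=> ->; rewrite mul0mx => /rowP E; apply: (gE a a' (- k)).
  apply/eqP; rewrite mulNmx -addr_eq0; apply/eqP/rowP => i.
  have := E i; rewrite [in LHS]mxE [in RHS]mxE => /esym/eqP.
  by rewrite intr_eq0 => /eqP ->; rewrite mxE.
have [/injectiveP f_inj|/injectivePn[a [a' neq eqf]]] := boolP (injectiveb f); last first.
  pose u : 'rV[rat]_l := \row_i (((a.2 i : nat)%:R - (a'.2 i : nat)%:R) / M%:R).
  have [k kE] : exists k, u *m mxQ K = ratv (g a'.1 - g a.1 + k *m K).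
    apply: (@latt (fun i => a.2 i) (g a.1) a') => // i; apply: (@residue_eq _ M0).
    by move/ffunP/(_ i): eqf; rewrite !ffunE.
  have u_bound i : `|u ord0 i| < b i.
    rewrite mxE bB normrM normfV [`|M%:R|]ger0_norm ?ler0n // ltr_pM2r ?invr_gt0 //.
    have := ltn_ord (a.2 i); have := ltn_ord (a'.2 i).
    rewrite -!(ltr_nat rat) ltr_norml => lt1 lt2.
    have a0 := ler0n rat (a.2 i); have a0' := ler0n rat (a'.2 i).
    by apply/andP; split; move: a0 a0' lt1 lt2; lra.
  exists u; last by left.
  split; last by exists (g a'.1 - g a.1 + k *m K).
  apply/negP => /eqP u0; case/eqP: neq.
  have a1 := no0 _ _ _ _ u0 kE.
  have a2 i : a.2 i = a'.2 i.
    have /rowP/(_ i)/eqP := u0; rewrite !mxE mulf_eq0 invr_eq0 (negPf M0r) orbF subr_eq0 eqr_nat.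
    by move/eqP/val_inj.
  by rewrite [a]surjective_pairing [a']surjective_pairing a1; congr (_, _); apply/ffunP.
have card_dom : #|{: T * box}| = (N * \prod_i B i)%N by rewrite card_prod cardT card_dffun_ord.
have card_cod : #|{ffun 'I_l -> 'I_M}| = (M ^ l)%N by rewrite card_ffun !card_ord.
have prodB : (\prod_i B i)%:R = (M ^ l)%:R * \prod_i b i :> rat.
  have -> : (M ^ l)%:R = \prod_(i < l) M%:R :> rat by rewrite prodr_const card_ord natrX.
  rewrite natr_prod -big_split /=.
  by apply: eq_bigr => i _; rewrite bB mulrC divfK.
have Ml0 : 0 < (M ^ l)%:R :> rat by rewrite ltr0n expn_gt0 M0.
have NE : N%:R * \prod_i b i = #|{: T * box}|%:R / #|{ffun 'I_l -> 'I_M}|%:R.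
  by rewrite card_dom card_cod natrM prodB mulrA mulrAC mulfK ?gt_eqF // mulrC.
have le_card := leq_card f f_inj.
have eq1 : N%:R * \prod_i b i = 1.
  apply/eqP; rewrite eq_le ge1 andbT NE ler_pdivrMr ?mul1r ?ler_nat //.
  by rewrite card_cod.
have eq_card : #|{: T * box}| = #|{ffun 'I_l -> 'I_M}|.
  apply/eqP; rewrite -(eqr_nat rat); move: eq1; rewrite NE => /divr1_eq -> //.
(* The translates now tile. This corner lies just outside the half-open box, so its difference with
   the box point that covers it is a lattice vector, positive at [i0] and nonpositive at the other
   indices. *)
pose x i := if i == i0 then B i0 else 0%N.
have /codomP[a aE] := inj_card_onto f_inj (eq_leq (esym eq_card)) [ffun i => residue M0 (x i)%:Z].
pose u : 'rV[rat]_l := \row_i (((x i)%:R - (a.2 i : nat)%:R) / M%:R).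
have [k kE] : exists k, u *m mxQ K = ratv (g a.1 - 0 + k *m K).
  apply: (@latt x 0 a) => // i; apply: (@residue_eq _ M0).
  by move/ffunP/(_ i): aE; rewrite !ffunE mul0mx mxE addr0.
have u_i i : i != i0 -> - b i < u ord0 i <= 0.
  move=> /negPf ne; rewrite mxE /x ne bB sub0r mulNr ltrN2 oppr_le0 divr_ge0 ?ler0n // andbT.
  by rewrite ltr_pM2r ?invr_gt0 // ltr_nat.
have u_i0 : 0 < u ord0 i0 <= b i0.
  rewrite mxE /x eqxx bB ler_pM2r ?invr_gt0 // gerBl ler0n andbT.
  by rewrite mulr_gt0 ?invr_gt0 // subr_gt0 ltr_nat.
exists u; first split.
- by apply/eqP => /rowP/(_ i0); move: u_i0 => /[swap] ->; rewrite mxE ltxx.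
- by exists (g a.1 - 0 + k *m K).
have [ltb|leb] := ltP (u ord0 i0) (b i0).
  left=> i; have [->|/u_i] := eqVneq i i0; first by rewrite gtr0_norm; case/andP: u_i0.
  by case/andP=> ? ?; have := b_gt0 i; rewrite ltr_norml => ?; apply/andP; split; lra.
right; split=> //; apply/eqP; rewrite eq_le leb andbT; by case/andP: u_i0.
Qed.

End Box.

(* Pigeonhole for the lattice of the vectors k beta - t, where k is the sum of t,
   which has covolume the sum of beta over the complement of J: modulo that
   lattice an integral point x of the scaled box is determined by [sum x mod e]
   and by the residues of [x i + (sum x div e) b i] for i in J minus one index. *)
Lemma simultaneous_approx (I : finType) (beta : I -> rat) (J : {set I}) :
  (forall i, 0 < beta i) -> \sum_i beta i = 1 -> J != setT ->
  \sum_(i in ~: J) beta i < \prod_(i in J) beta i ->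
  exists (k : int) (t : I -> int),
    [/\ 0 < k, \sum_i t i = k, (forall i, i \notin J -> t i = 0) &
        forall i, i \in J -> `|k%:~R * beta i - (t i)%:~R| < beta i].
Proof.
move=> beta0 sum1 JT lt_prod.
have [M M0 [b bE]] := common_denominator (fun i => ltW (beta0 i)).
have M0r : 0 < M%:R :> rat by rewrite ltr0n.
have Mn0 : M%:R != 0 :> rat by rewrite gt_eqF.
have b0 i : (0 < b i)%N.
  by have := beta0 i; rewrite bE pmulr_lgt0 ?invr_gt0 // ltr0n.
pose e := (\sum_(i in ~: J) b i)%N.
have sumb : (\sum_i b i = M)%N.
  apply/eqP; rewrite -(eqr_nat rat) natr_sum; apply/eqP.
  have -> : M%:R = (\sum_i beta i) * M%:R by rewrite sum1 mul1r.
  by rewrite big_distrl /=; apply: eq_bigr => i _; rewrite bE divfK.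
have sumJ : (\sum_(i in J) b i + e = M)%N.
  rewrite -sumb [RHS](bigID (mem J)) /=; congr (_ + _)%N.
  by apply: eq_bigl => i; rewrite inE.
have e0 : (0 < e)%N.
  have /subsetPn[i _ iJ] : ~~ (setT \subset J) by rewrite subTset.
  by rewrite /e (bigD1 i) ?inE //= ltn_addr.
have leb i : (b i <= M)%N by rewrite -sumb (bigD1 i) //= leq_addr.
have epsE : \sum_(i in ~: J) beta i = e%:R / M%:R.
  by rewrite natr_sum big_distrl /=; apply: eq_bigr => i _.
have [J0|/set0Pn[i0 i0J]] := eqVneq J set0.
  move: lt_prod; rewrite J0 big_set0 (eq_bigl xpredT) ?sum1 ?ltxx // => i.
  by rewrite !inE.
pose B i := if i \in J then b i else 1%N.
pose C i := if i \in J :\ i0 then M else 1%N.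
have C0 i : (0 < C i)%N by rewrite /C; case: ifP.
pose box := {dffun forall i : I, 'I_(B i)}.
pose S (x : box) := (\sum_i x i)%N.
pose kap (x : box) := (S x %/ e)%N.
pose f (x : box) : 'I_e * {dffun forall i : I, 'I_(C i)} :=
  (Ordinal (ltn_pmod (S x) e0),
   [ffun i => Ordinal (ltn_pmod (x i + kap x * b i) (C0 i))]).
(* The box has M^|J| times the product of [beta] over J points, against e M^(|J|-1) values of [f];
   the hypothesis is that the product exceeds e / M. *)
have ninj : ~ injective f.
  move=> f_inj; have := leq_card f f_inj.
  rewrite card_prod !card_dffun_ord card_ord leqNgt => /negP; apply.
  rewrite -(ltr_nat rat) natrM !natr_prod.
  have -> : \prod_i (C i)%:R = \prod_(i in J :\ i0) M%:R :> rat.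
    by rewrite [RHS]big_mkcond /=; apply: eq_bigr => i _; rewrite /C; case: ifP.
  have -> : \prod_i (B i)%:R = \prod_(i in J) (M%:R * beta i) :> rat.
    rewrite [RHS]big_mkcond /=; apply: eq_bigr => i _; rewrite /B; case: ifP => // _.
    by rewrite bE mulrC divfK.
  rewrite big_split /= [\prod_(i in J) M%:R](big_setD1 i0) //= mulrAC.
  rewrite ltr_pM2r; last by apply: prodr_gt0.
  by rewrite mulrC -ltr_pdivrMr // -epsE.
have /injectivePn[x [x' /eqP neq eqf]] : ~~ injectiveb f by apply/injectiveP.
have xout (y : box) i : i \notin J -> (y i : nat) = 0%N.
  move=> /negPf iJ; have := ltn_ord (y i); move: (nat_of_ord (y i)) => c.
  by rewrite /B iJ; case: c.
have SJ y : S y = (\sum_(i in J) y i)%N.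
  rewrite /S (bigID (mem J)) /= [X in (_ + X)%N]big1 ?addn0 // => i; exact: xout.
have eqS : S x = S x' %[mod e] by case: eqf.
have eqx i : i \in J :\ i0 -> x i + kap x * b i = x' i + kap x' * b i %[mod M].
  move=> iJ; have /ffunP/(_ i) := congr1 snd eqf; rewrite !ffunE => /(congr1 val) /=.
  by rewrite /C iJ.
have PoszE (F : I -> nat) : (\sum_(i in J) F i)%N%:Z = \sum_(i in J) (F i)%:Z.
  exact: (big_morph Posz PoszD (erefl _)).
pose D i : int := (x i : nat)%:Z - (x' i : nat)%:Z.
pose k : int := (kap x)%:Z - (kap x')%:Z.
have sumD : \sum_(i in J) D i = k * e%:Z.
  rewrite /D sumrB -!PoszE -!SJ /k mulrBl -!PoszM.
  have := divn_eq (S x) e; have := divn_eq (S x') e; rewrite eqS /kap; lia.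
have sumY : \sum_(i in J) (D i + k * (b i)%:Z) = k * M%:Z.
  rewrite big_split /= sumD -mulr_sumr -PoszE -mulrDr -PoszD.
  by rewrite addnC sumJ.
have dvdY i : i \in J -> (M%:Z %| D i + k * (b i)%:Z)%Z.
  have Hi j : j \in J :\ i0 -> (M%:Z %| D j + k * (b j)%:Z)%Z.
    move=> /eqx /eqP; rewrite -eqz_nat -!modz_nat eqz_mod_dvd !PoszD !PoszM.
    rewrite (_ : _ - _ = D j + k * (b j)%:Z) //.
    by rewrite /D /k; ring.
  (* No residue is recorded at [i0]: divisibility there follows from that of the sum over J. *)
  move=> iJ; have [->|ne] := eqVneq i i0; last by apply: Hi; rewrite !inE ne.
  have := sumY; rewrite (big_setD1 i0) //= => /(canRL (addrK _)) ->.
  by rewrite rpredB ?dvdz_mull ?rpred_sum.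
pose t i : int := if i \in J then ((D i + k * (b i)%:Z) %/ M%:Z)%Z else 0.
have tE i : i \in J -> t i * M%:Z = D i + k * (b i)%:Z.
  by move=> iJ; rewrite /t iJ divzK // dvdY.
have tsum : \sum_i t i = k.
  have Mz : M%:Z != 0 by rewrite -lt0n.
  apply: (mulIf Mz); rewrite -sumY mulr_suml [RHS]big_mkcond /=; apply: eq_bigr => i _.
  by case: ifP => [/tE//|iJ]; rewrite /t iJ mul0r.
have ltD i : i \in J -> (`|D i|%N < b i)%N.
  move=> iJ; have := ltn_ord (x i); have := ltn_ord (x' i).
  rewrite /D; move: (nat_of_ord (x i)) (nat_of_ord (x' i)) => c c'.
  by rewrite /B iJ; lia.
(* With k = 0 every [D i] would be a multiple of M smaller than [b i] <= M, hence 0, and the two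
   colliding points would coincide. *)
have k_neq0 : k != 0.
  apply/eqP => k0; apply: neq; apply/ffunP => i; apply: val_inj => /=.
  have [iJ|iJ] := boolP (i \in J); last by rewrite !xout.
  have := tE i iJ; rewrite k0 mul0r addr0 => E.
  have := ltD i iJ; rewrite -E abszM /= => lt.
  have t0 : t i = 0.
    apply/eqP; rewrite -absz_eq0; move: lt (leb i); case: (`|t i|)%N => // c.
    by rewrite mulSn; lia.
  by move/esym/eqP: E; rewrite t0 mul0r /D subr_eq0 eqz_nat => /eqP.
have approx i : i \in J -> `|k%:~R * beta i - (t i)%:~R| < beta i.
  move=> iJ.
  have -> : k%:~R * beta i - (t i)%:~R = - (D i)%:~R / M%:R.
    have := congr1 (fun c : int => c%:~R : rat) (tE i iJ).
    rewrite rmorphM rmorphD rmorphM /= bE -!pmulrn => E.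
    apply: (mulIf Mn0); rewrite mulrBl mulrA !divfK // E; ring.
  rewrite normrM normfV normrN bE [`|M%:R|]ger0_norm ?ler0n // ltr_pM2r ?invr_gt0 //.
  by rewrite -intr_norm -natr_absz ltr_nat ltD.
have [k_gt0|k_lt0|/eqP] := ltgtP 0 k; last by rewrite eq_sym (negPf k_neq0).
- exists k, t; split=> // i /negPf iJ; by rewrite /t iJ.
- exists (- k), (fun i => - t i); split.
  + by rewrite oppr_gt0.
  + by rewrite sumrN tsum.
  + by move=> i /negPf iJ; rewrite /t iJ oppr0.
  + by move=> i iJ; rewrite !rmorphN /= mulNr -opprD normrN approx.
Qed.

(** * Normalized volume as a lattice index *)

Lemma det_gram_neq0 (F : realFieldType) m n (A : 'M[F]_(m, n)) :
  row_free A -> \det (A *m A^T) != 0.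
Proof.
move=> Afree; apply/negP => /det0P[x x0 xA]; case/eqP: x0.
apply: (row_free_inj Afree); rewrite mul0mx; apply/rowP => j; rewrite [RHS]mxE.
have /matrixP/(_ 0 0) : (x *m A) *m (x *m A)^T = 0.
  by rewrite trmx_mul mulmxA -[x *m A *m A^T]mulmxA xA mul0mx.
move: (x *m A) => y; rewrite !mxE => /eqP; rewrite psumr_eq0 => [|i _]; last by rewrite !mxE -expr2 sqr_ge0.
by move=> /allP/(_ j (mem_index_enum _)); rewrite /= mxE mulf_eq0 orbb => /eqP.
Qed.

Lemma row_free_mulmx (F : fieldType) m n (A : 'M[F]_m) (B : 'M[F]_(m, n)) :
  row_free (A *m B) -> row_free A /\ row_free B.
Proof.
rewrite /row_free => /eqP rk.
have := mxrankM_maxl A B; have := mxrankM_maxr A B.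
by rewrite rk !eqn_leq !rank_leq_row => -> ->.
Qed.

(** The first l rows of the unimodular right factor [R] of the Smith form work: an integral vector
    of the span has integral coordinates in the rows of [R], and only the first l can be nonzero. *)
Lemma lattice_basis_exists d l (E : 'M[int]_(l, d)) : row_free (mxQ E) ->
  exists B, is_lattice_basis E B.
Proof.
move=> Efree; have [L Lu [R Ru [c _ EE]]] := int_Smith_normal_form E.
have led : (l <= d)%N by move: Efree => /eqP <-; exact: rank_leq_col.
pose P : 'M[int]_(l, d) := pid_mx l.
have PPT : P *m P^T = 1%:M by rewrite tr_pid_mx mul_pid_mx minnn (minn_idPr _) // pid_mx_1.
pose K := L *m diag_mx (\row_i c`_i).
have {}EE : E = K *m (P *m R).
  rewrite EE /K -!mulmxA; congr (_ *m _); rewrite mulmxA; congr (_ *m _).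
  apply/matrixP => i j; rewrite mul_diag_mx !mxE ltn_ord andbT.
  by case: eqP => _; rewrite ?mulr1 ?mulr0.
have Ku : mxQ K \in unitmx.
  by move: Efree; rewrite -row_free_unit EE mxQM => /row_free_mulmx[].
exists (P *m R) => z; split=> [[a zE]|[k ->]]; last first.
  exists (ratv k *m invmx (mxQ K)).
  by rewrite EE [mxQ (K *m _)]mxQM [RHS]mulmxA mulmxKV //; exact: mxQM.
pose y := z *m invmx R.
have zy : z = y *m R by rewrite mulmxKV.
have yE : mxQ y = a *m mxQ K *m mxQ P.
  have : mxQ y *m mxQ R = a *m mxQ K *m mxQ P *m mxQ R.
    by rewrite -mxQM -zy -!mulmxA -!mxQM -EE.
  have RQu : mxQ R \in unitmx.
    by rewrite unitmxE det_mxQ unitfE intr_eq0; move: Ru; rewrite unitmxE => /orP[]/eqP->.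
  by move/(congr1 (mulmx^~ (invmx (mxQ R)))); rewrite /= !mulmxK.
exists (y *m P^T); rewrite {1}zy mulmxA; congr (_ *m _); apply: mxQ_inj.
rewrite [mxQ (_ *m P)]mxQM [mxQ (y *m _)]mxQM yE -!mulmxA -!mxQM.
by rewrite [P *m (_ *m _)]mulmxA PPT mul1mx.
Qed.

Lemma mxCM m n k (A : 'M[int]_(m, n)) (B : 'M[int]_(n, k)) :
  mxC (A *m B) = mxC A *m mxC B.
Proof. exact: map_mxM. Qed.

Lemma mxC_gram m n (A : 'M[int]_(m, n)) :
  \det (mxC A *m (mxC A)^T) = (\det (A *m A^T))%:~R.
Proof. by rewrite /mxC map_trmx -/(mxC A) -/(mxC A^T) -mxCM; exact: det_map_mx. Qed.

Lemma sqrtC_gramM l d (K : 'M[int]_l) (B : 'M[int]_(l, d)) :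
  sqrtC (\det (mxC (K *m B) *m (mxC (K *m B))^T)) =
    `|\det K|%N%:R * sqrtC (\det (mxC B *m (mxC B)^T)).
Proof.
rewrite !mxC_gram trmx_mul mulmxA -[K *m B *m B^T]mulmxA !det_mulmx det_tr mulrAC.
rewrite rmorphM /= rootCMl; last by rewrite ler0z -expr2 sqr_ge0.
congr (_ * _); rewrite -expr2 rmorphXn /= natr_absz intr_norm.
by rewrite -real_normK ?realz // sqrCK.
Qed.

(** The Gram determinants of the edges and of the basis picked by [epsilon] differ by the square of
    [\det K], so the square roots cancel and the index of the edge lattice remains. *)
Lemma volZ_index d l (E : 'M[int]_(l, d)) : row_free (mxQ E) ->
  exists (K : 'M[int]_l) (B : 'M[int]_(l, d)),
    [/\ is_lattice_basis E B, E = K *m B & volZ E = `|\det K|%N%:R / (l`!)%:R].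
Proof.
move=> Efree; rewrite /volZ /euclid_vol /lattice_det.
set B := epsilon _ _.
have Bbasis : is_lattice_basis E B by apply: epsilon_spec; exact: lattice_basis_exists.
have /fin_all_exists[k kE] i : exists k : 'rV[int]_l, row i E = k *m B.
  apply/Bbasis; exists (delta_mx 0 i); rewrite -rowE.
  by apply/rowP => j; rewrite !mxE.
pose K := \matrix_i k i.
have EE : E = K *m B by apply/row_matrixP => i; rewrite row_mul rowK kE.
exists K, B; split=> //.
have Bfree : row_free (mxQ B).
  by move: Efree; rewrite {1}EE mxQM => /row_free_mulmx[].
have g0 : sqrtC (\det (mxC B *m (mxC B)^T)) != 0.
  rewrite sqrtC_eq0 mxC_gram intr_eq0.
  have := det_gram_neq0 Bfree; rewrite {2}/mxQ map_trmx -/(mxQ B^T) -mxQM det_mxQ intr_eq0.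
  by [].
by rewrite {1 2}EE sqrtC_gramM mulrAC mulfK // mulrAC.
Qed.

(** * Simplices with one interior lattice point *)

Definition base_edges l d (w : 'I_l.+1 -> 'rV[int]_d) (r : 'I_l.+1) : 'M[int]_(l, d) :=
  \matrix_(i, k) (w (lift r i) 0 k - w r 0 k).

(** [volZ] is read off the edges at vertex 0 of the face, while the estimates need the edges at the
    vertex of smallest coordinate; this matrix passes between them and has determinant 1 or -1. *)
Definition base_change l (r r0 : 'I_l.+1) : 'M[int]_l :=
  \matrix_(i, j) ((lift r i == lift r0 j)%:R - (r == lift r0 j)%:R).

Lemma sum_indicatorB (R : pzRingType) l (a b : 'I_l) (F : 'I_l -> R) :
  \sum_i ((a == i)%:R - (b == i)%:R) * F i = F a - F b.
Proof.
have sum1 c : \sum_i (c == i)%:R * F i = F c.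
  rewrite (bigD1 c) //= eqxx mul1r big1 ?addr0 // => i /negPf ic.
  by rewrite eq_sym ic mul0r.
by under eq_bigr do rewrite mulrBl; rewrite sumrB !sum1.
Qed.

Lemma base_change_edges l d (w : 'I_l.+1 -> 'rV[int]_d) r r0 :
  base_edges w r = base_change r r0 *m base_edges w r0.
Proof.
apply/matrixP => i k; rewrite !mxE.
under eq_bigr do rewrite !mxE.
have := sum_indicatorB (lift r i) r (fun a => w a 0 k - w r0 0 k).
by rewrite (bigD1_ord r0) //= subrr mulr0 add0r => ->; ring.
Qed.

Lemma base_changeV l (r r0 : 'I_l.+1) : base_change r r0 *m base_change r0 r = 1%:M.
Proof.
apply/matrixP => i k; rewrite !mxE.
under eq_bigr do rewrite !mxE.
have := sum_indicatorB (lift r i) r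
  (fun a => (a == lift r k)%:R - (r0 == lift r k)%:R : int).
rewrite (bigD1_ord r0) //= subrr mulr0 add0r => ->.
by rewrite (inj_eq (@lift_inj _ r)) (negPf (neq_lift r k)) sub0r opprK subrK.
Qed.

Lemma absz_det_base_change l (r r0 : 'I_l.+1) : `|\det (base_change r r0)|%N = 1%N.
Proof.
have := congr1 (fun A => `|\det A|%N) (base_changeV r r0).
by rewrite /= det_mulmx det1 abszM => /eqP; rewrite muln_eq1 => /andP[/eqP].
Qed.

Section Simplex.
Variables (d : nat) (v : 'I_d.+1 -> 'rV[int]_d).
Hypothesis v_full : full_dim v.

Lemma full_simplex_edgesE : full_simplex_edges v = base_edges v ord0.
Proof.
apply/matrixP => i k; rewrite !mxE; congr (v _ _ _ - v _ _ _).
  by apply: val_inj; rewrite /= inordK // ltnS.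
by apply: val_inj; rewrite /= inordK.
Qed.

Lemma row_base_edges l (w : 'I_l.+1 -> 'rV[int]_d) r (u : 'rV[rat]_l) :
  u *m mxQ (base_edges w r) = \sum_i u 0 i *: (ratv (w (lift r i)) - ratv (w r)).
Proof.
apply/rowP => k; rewrite !mxE summxE; apply: eq_bigr => i _.
by rewrite !mxE rmorphB.
Qed.

Lemma bary_unique (c : 'I_d.+1 -> rat) :
  \sum_i c i = 0 -> \sum_i c i *: ratv (v i) = 0 -> forall i, c i = 0.
Proof.
move=> sum0 comb0.
pose u : 'rV[rat]_d := \row_i c (lift ord0 i).
have u0 : u = 0.
  have uE : u *m mxQ (base_edges v ord0) = 0.
    rewrite row_base_edges.
    under eq_bigr do rewrite mxE scalerBr.
    rewrite sumrB -scaler_suml.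
    move: sum0 comb0; rewrite !(bigD1_ord ord0) //= => /eqP; rewrite addr_eq0 => /eqP->.
    by rewrite scaleNr addrC => ->.
  have Eu : mxQ (base_edges v ord0) \in unitmx.
    by rewrite unitmxE unitfE -full_simplex_edgesE.
  by rewrite -(mulmxK Eu u) uE mul0mx.
have c0 i : c (lift ord0 i) = 0 by have /rowP/(_ i) := u0; rewrite !mxE.
move=> i; case: (unliftP ord0 i) => [j ->|->]; first exact: c0.
by move: sum0; rewrite (bigD1_ord ord0) //= big1 ?addr0.
Qed.

Section Extension.
Variables (l : nat) (f : 'I_l.+1 -> 'I_d.+1) (r : 'I_l.+1) (u : 'rV[rat]_l).
Hypothesis f_inj : injective f.

(** A combination of the edges at r, rewritten as barycentric coefficients of sum 0 so that it can
    be added to [beta]. *)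
Definition face_coef (j : 'I_l.+1) : rat :=
  if unlift r j is Some i then u 0 i else - \sum_i u 0 i.
Definition face_ext (a : 'I_d.+1) : rat := \sum_(j | f j == a) face_coef j.

Lemma face_ext_base : face_ext (f r) = - \sum_i u 0 i.
Proof.
rewrite /face_ext (eq_bigl (pred1 r)) => [|j]; last by rewrite /= (inj_eq f_inj).
by rewrite big_pred1_eq /face_coef unlift_none.
Qed.

Lemma face_ext_lift i : face_ext (f (lift r i)) = u 0 i.
Proof.
rewrite /face_ext (eq_bigl (pred1 (lift r i))) => [|j]; last by rewrite /= (inj_eq f_inj).
by rewrite big_pred1_eq /face_coef liftK.
Qed.

Lemma face_ext_out a : (forall j, f j != a) -> face_ext a = 0.
Proof. by move=> na; rewrite /face_ext big_pred0 // => j; rewrite (negPf (na j)). Qed.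

Lemma face_extP (P : 'I_d.+1 -> rat -> Prop) :
  P (f r) (- \sum_i u 0 i) -> (forall i, P (f (lift r i)) (u 0 i)) ->
  (forall a, P a 0) -> forall a, P a (face_ext a).
Proof.
move=> Pr Pi Pout a.
have [/existsP[j /eqP <-]|/existsPn na] := boolP [exists j, f j == a].
  by case: (unliftP r j) => [i ->|->]; rewrite ?face_ext_lift ?face_ext_base.
by rewrite face_ext_out.
Qed.

Lemma face_ext_comb (V : lmodType rat) (X : 'I_d.+1 -> V) :
  \sum_a face_ext a *: X a = \sum_i u 0 i *: (X (f (lift r i)) - X (f r)).
Proof.
transitivity (\sum_j face_coef j *: X (f j)).
  rewrite (partition_big f xpredT) //=; apply: eq_bigr => a _.
  by rewrite scaler_suml; apply: eq_bigr => j /eqP ->.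
rewrite (bigD1_ord r) //= /face_coef unlift_none scaleNr scaler_suml addrC.
under [in LHS]eq_bigr do rewrite liftK.
by under [in RHS]eq_bigr do rewrite scalerBr; rewrite sumrB.
Qed.

Lemma face_ext_sum : \sum_a face_ext a = 0.
Proof.
have := face_ext_comb (fun=> 1 : rat^o).
under eq_bigr do rewrite /GRing.scale /= mulr1.
by move=> ->; rewrite big1 // => i _; rewrite subrr scaler0.
Qed.

End Extension.

Lemma base_edges_free l (f : 'I_l.+1 -> 'I_d.+1) r : injective f ->
  row_free (mxQ (base_edges (v \o f) r)).
Proof.
move=> f_inj; apply: inj_row_free => u; rewrite row_base_edges => u0.
have := bary_unique (face_ext_sum f r u); rewrite face_ext_comb => /(_ u0) c0.
by apply/rowP => i; rewrite -(face_ext_lift r u f_inj) c0 mxE.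
Qed.

Variables (beta : 'I_d.+1 -> rat) (z0 : 'rV[int]_d).
Hypotheses (beta_gt0 : forall i, 0 < beta i) (beta_sum : \sum_i beta i = 1).
Hypothesis z0E : ratv z0 = \sum_i beta i *: ratv (v i).
Hypothesis z0_unique : forall z, in_interior v (ratv z) -> z = z0.

(** Every later use of the uniqueness of the interior lattice point goes through this form. *)
Lemma interior_shift (c : 'I_d.+1 -> rat) y : \sum_i c i = 0 ->
  \sum_i c i *: ratv (v i) = ratv y -> (forall i, 0 < beta i + c i) ->
  forall i, c i = 0.
Proof.
move=> sum0 comb pos; apply: bary_unique => //.
have addE : ratv (z0 + y) = \sum_i (beta i + c i) *: ratv (v i).
  under eq_bigr do rewrite scalerDl.
  by rewrite big_split /= -z0E comb; apply/rowP => k; rewrite !mxE rmorphD.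
have /z0_unique/eqP : in_interior v (ratv (z0 + y)).
  by exists (fun i => beta i + c i); rewrite big_split /= beta_sum sum0 addr0.
rewrite comb -subr_eq0 addrC addKr => /eqP ->.
by apply/rowP => k; rewrite !mxE.
Qed.

(** Otherwise the shift k [beta] - t is admissible: inside J it is smaller than [beta] in absolute
    value, and outside J it equals k [beta] > 0, which also shows that it is nonzero. *)
Lemma beta_prod_sum (J : {set 'I_d.+1}) : J != setT ->
  \prod_(i in J) beta i <= \sum_(i in ~: J) beta i.
Proof.
move=> JT; rewrite leNgt; apply/negP => lt_prod.
have [k [t [k0 tsum tout approx]]] := simultaneous_approx beta_gt0 beta_sum JT lt_prod.
have k0r : 0 < k%:~R :> rat by rewrite ltr0z.
pose c i := k%:~R * beta i - (t i)%:~R.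
have c0 : forall i, c i = 0.
  apply: (@interior_shift c (k *: z0 - \sum_i t i *: v i)).
  - by rewrite sumrB -mulr_sumr beta_sum mulr1 -rmorph_sum /= tsum subrr.
  - under eq_bigr do rewrite scalerBl -scalerA.
    rewrite sumrB -scaler_sumr -z0E; apply/rowP => j.
    rewrite !mxE !summxE rmorphB rmorphM rmorph_sum /=; congr (_ - _).
    by apply: eq_bigr => i _; rewrite !mxE rmorphM.
  - move=> i; have [iJ|iJ] := boolP (i \in J).
      by have := approx i iJ; rewrite ltr_norml => /andP[? _]; rewrite /c; lra.
    rewrite /c tout // subr0; have := beta_gt0 i; nra.
have /subsetPn[i _ iJ] : ~~ (setT \subset J) by rewrite subTset.
have := c0 i; rewrite /c tout // subr0 => /eqP; rewrite mulf_eq0 !gt_eqF //.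
Qed.

Section Face.
Variables (l : nat) (f : 'I_l.+1 -> 'I_d.+1) (r : 'I_l.+1).
Variables (K : 'M[int]_l) (B : 'M[int]_(l, d)).
Hypotheses (f_inj : injective f) (KB : base_edges (v \o f) ord0 = K *m B).

Let N : rat := `|\det K|%N%:R.
Let P : rat := \prod_i beta (f (lift r i)).

Lemma face_no_short_vector (u : 'rV[rat]_l) y :
  u *m mxQ (base_edges (v \o f) r) = ratv y ->
  - \sum_i u 0 i > - beta (f r) -> (forall i, - beta (f (lift r i)) < u 0 i) -> u = 0.
Proof.
move=> uy ur ui.
have c0 : forall a, face_ext f r u a = 0.
  apply: (@interior_shift _ y); first exact: face_ext_sum.
  - by rewrite face_ext_comb -uy row_base_edges.
  apply: (face_extP f_inj (P := fun a c => 0 < beta a + c)).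
  - by move: ur; lra.
  - by move=> i; have := ui i; lra.
  - by move=> a; rewrite addr0.
by apply/rowP => i; rewrite -(face_ext_lift r u f_inj) c0 mxE.
Qed.

Lemma face_lattice_point i0 : 1 <= N * P ->
  exists2 u : 'rV[rat]_l, u != 0 /\ (exists y, u *m mxQ (base_edges (v \o f) r) = ratv y) &
    (forall i, `|u ord0 i| < beta (f (lift r i))) \/
    [/\ N * P = 1, u ord0 i0 = beta (f (lift r i0)) &
        forall i, i != i0 -> - beta (f (lift r i)) < u ord0 i <= 0].
Proof.
pose T := base_change r ord0.
have NT : `|\det (T *m K)|%N = `|\det K|%N by rewrite det_mulmx abszM absz_det_base_change mul1n.
move=> ge1.
have K0 : \det K != 0.
  by apply: contraTneq ge1 => K0; rewrite /N K0 mul0r -ltNge ltr01.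
have [] := @box_lattice_point _ (T *m K) (fun i => beta (f (lift r i))) _ _ i0.
- by rewrite -absz_eq0 NT absz_eq0.
- by [].
- by rewrite NT.
move=> u [u0 [z uz]] alt; exists u; last by rewrite NT in alt.
split=> //; exists (z *m B).
by rewrite (base_change_edges _ r ord0) KB mulmxA mxQM mulmxA uz -mxQM.
Qed.

(** The box controls all coordinates except the one at r, which is minus the sum of u. That one is
    nonnegative for u or for -u, and the box is symmetric. *)
Lemma face_no_small_vector (u : 'rV[rat]_l) y :
  u *m mxQ (base_edges (v \o f) r) = ratv y ->
  (forall i, `|u ord0 i| < beta (f (lift r i))) -> u = 0.
Proof.
move=> uy ui.
have ui' i : - beta (f (lift r i)) < u 0 i /\ - beta (f (lift r i)) < - u 0 i.
  by have := ui i; rewrite ltr_norml => /andP[? ?]; split; lra.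
have br := beta_gt0 (f r).
have [le0|ge0] := lerP (\sum_i u 0 i) 0.
  by apply: (face_no_short_vector uy) => [|i]; [lra | case: (ui' i)].
apply/eqP; rewrite -oppr_eq0; apply/eqP; apply: (@face_no_short_vector (- u) (- y)).
- by rewrite mulNmx uy; apply/rowP => k; rewrite !mxE rmorphN.
- by under eq_bigr do rewrite mxE; rewrite sumrN; lra.
- by move=> i; rewrite mxE; case: (ui' i).
Qed.

Lemma face_index_le : (0 < l)%N -> N * P <= 1.
Proof.
move=> l0; rewrite leNgt; apply/negP => lt1.
have [u [/eqP u0 [y uy]] [ui|[eq1 _ _]]] := face_lattice_point (Ordinal l0) (ltW lt1).
  exact/u0/(face_no_small_vector uy).
by rewrite eq1 ltxx in lt1.
Qed.

(* The vector u given by the tiling satisfies u_i0 = beta_i0 and u_i <= 0 otherwise;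
   unless all these u_i vanish, beta + u is an interior point. *)
Lemma face_index_eq i0 : N * P = 1 -> beta (f (lift r i0)) <= beta (f r) ->
  exists y, beta (f (lift r i0)) *: (ratv (v (f (lift r i0))) - ratv (v (f r))) = ratv y.
Proof.
move=> NP1 le_r.
have [|u [/eqP u0 [y uy]] alt] := @face_lattice_point i0; first by rewrite NP1.
have br := beta_gt0 (f r); have bi := beta_gt0 (f (lift r i0)).
case: alt => [ui|[_ ui0 ui]]; first by case: u0; exact: face_no_small_vector uy ui.
rewrite -[u ord0 i0]/(u 0 i0) in ui0.
have uneg i : i != i0 -> u 0 i <= 0 by case/ui/andP.
have sum_ge : beta (f r) <= \sum_i u 0 i.
  rewrite leNgt; apply/negP => lt_r; apply: u0.
  apply: (face_no_short_vector uy); first by lra.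
  by move=> i; have [->|/ui/andP[//]] := eqVneq i i0; rewrite ui0; lra.
have uE i : i != i0 -> u 0 i = 0.
  move: sum_ge; rewrite (bigD1 i0) //= ui0 => sum_ge ne.
  have : \sum_(j < l | j != i0) - u 0 j = 0.
    apply/eqP; rewrite eq_le sumr_ge0 ?andbT => [|j /uneg]; last by rewrite oppr_ge0.
    by rewrite sumrN; lra.
  move/eqP; rewrite psumr_eq0 => [|j /uneg]; last by rewrite oppr_ge0.
  by move/allP/(_ i (mem_index_enum _)); rewrite ne oppr_eq0 => /eqP.
exists y; rewrite -uy row_base_edges (bigD1 i0) //= big1 ?addr0 => [|i /uE ->].
  2: by rewrite scale0r.
by rewrite ui0.
Qed.

End Face.
End Simplex.

(** * Lattice indices of faces and the Sylvester bound *)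

Lemma two_smallest n (beta : 'I_n.+2 -> rat) : exists p q : 'I_n.+2,
  [/\ p != q, beta p <= beta q & forall i, i != p -> beta q <= beta i].
Proof.
have [p _ pmin] := @arg_minP _ _ _ ord0 xpredT beta isT.
have [q0 q0p] : exists q0, q0 != p.
  have /card_gt0P[q0] : (0 < #|predC1 p|)%N by rewrite cardC1 card_ord.
  by exists q0.
have [q qp qmin] := @arg_minP _ _ _ q0 (predC1 p) beta q0p.
by exists p, q; split=> //; [rewrite eq_sym | exact: pmin].
Qed.

Section OneInteriorPoint.
Variables (n : nat) (v : 'I_n.+2 -> 'rV[int]_n.+1).
Variables (beta : 'I_n.+2 -> rat) (z0 : 'rV[int]_n.+1) (p q : 'I_n.+2).
Hypotheses (n_ge2 : (2 <= n)%N) (v_full : full_dim v).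
Hypotheses (beta_gt0 : forall i, 0 < beta i) (beta_sum : \sum_i beta i = 1).
Hypothesis z0E : ratv z0 = \sum_i beta i *: ratv (v i).
Hypothesis z0_unique : forall z, in_interior v (ratv z) -> z = z0.
Hypotheses (neq_pq : p != q) (beta_pq : beta p <= beta q).
Hypothesis beta_q : forall i, i != p -> beta q <= beta i.

Let prod_sum := beta_prod_sum v_full beta_gt0 beta_sum z0E z0_unique.
Let prod_ge := beta_prod_ge n_ge2 beta_gt0 beta_sum prod_sum neq_pq beta_pq beta_q.

Section Index.
Variables (l : nat) (f : 'I_l.+1 -> 'I_n.+2).
Variables (K : 'M[int]_l) (B : 'M[int]_(l, n.+1)).
Hypotheses (l_gt0 : (0 < l)%N) (f_inj : injective f).
Hypothesis KB : base_edges (v \o f) ord0 = K *m B.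

Let L (r : 'I_l.+1) := [set f (lift r i) | i : 'I_l].

Lemma card_link r : #|L r| = l.
Proof. by rewrite card_imset ?card_ord // => i j /f_inj/lift_inj. Qed.

Lemma prod_link r : \prod_(a in L r) beta a = \prod_i beta (f (lift r i)).
Proof. by rewrite big_imset // => i j _ _ /f_inj/lift_inj. Qed.

(** Take p itself as base if it is a vertex of the face, and any vertex otherwise. *)
Lemma link_base : exists r, p \notin L r.
Proof.
have [/existsP[r /eqP fr]|/existsPn nf] := boolP [exists r, f r == p].
  exists r; apply/negP => /imsetP[i _]; rewrite -fr => /f_inj /eqP.
  by rewrite (negPf (neq_lift r i)).
by exists ord0; apply/negP => /imsetP[i _ pE]; have := nf (lift ord0 i); rewrite pE eqxx.
Qed.

Lemma index_link_le r : `|\det K|%N%:R * \prod_(a in L r) beta a <= 1.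
Proof.
rewrite prod_link.
exact: (face_index_le v_full beta_gt0 beta_sum z0E z0_unique r f_inj KB).
Qed.

Lemma link_prod_ge r : p \notin L r ->
  sylv_rem n ^+ 2 / (2 * sylv_rem (n.+1 - l)) <= \prod_(a in L r) beta a.
Proof. by move=> pL; have := prod_ge pL; rewrite card_link; exact. Qed.

Let Sm : rat := (sylv_prod (n.+1 - l))%:R.
Let Sn : rat := (sylv_prod n)%:R.
Let Sm_gt0 : 0 < Sm. Proof. by rewrite ltr0n sylv_prod_gt0. Qed.
Let Sn_gt0 : 0 < Sn. Proof. by rewrite ltr0n sylv_prod_gt0. Qed.

Lemma sylv_rem_ratio : sylv_rem n ^+ 2 / (2 * sylv_rem (n.+1 - l)) = Sm / (2 * Sn ^+ 2).
Proof. by rewrite /sylv_rem -/Sm -/Sn; field; rewrite !gt_eqF. Qed.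

Lemma index_bound : (`|\det K| * sylv_prod (n.+1 - l) <= 2 * sylv_prod n ^ 2)%N.
Proof.
have [r pL] := link_base.
have := index_link_le r; have := link_prod_ge pL; rewrite sylv_rem_ratio => ge le.
rewrite -(ler_nat rat) natrM [(2 * _)%:R]natrM natrX -/Sm -/Sn.
have N0 := ler0n rat `|\det K|%N.
have := le_trans (ler_wpM2l N0 ge) le.
by rewrite mulrA ler_pdivrMr ?mul1r // mulr_gt0 // exprn_gt0.
Qed.

Lemma index_eq_link r : p \notin L r ->
  (`|\det K| * sylv_prod (n.+1 - l) = 2 * sylv_prod n ^ 2)%N ->
  \prod_(a in L r) beta a = sylv_rem n ^+ 2 / (2 * sylv_rem (n.+1 - l)) /\
  `|\det K|%N%:R * \prod_(a in L r) beta a = 1.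
Proof.
move=> pL /(congr1 (fun k => k%:R : rat)); rewrite natrM [(2 * _)%:R]natrM natrX -/Sm -/Sn => NE.
have := index_link_le r; have := link_prod_ge pL; rewrite sylv_rem_ratio.
move: (\prod_(a in L r) beta a) => P ge le.
have N0 : 0 < `|\det K|%N%:R :> rat.
  by rewrite -(pmulr_lgt0 _ Sm_gt0) NE mulr_gt0 // exprn_gt0.
have QE : Sm / (2 * Sn ^+ 2) = `|\det K|%N%:R^-1.
  by rewrite -NE; field; rewrite !gt_eqF.
have PE : P = `|\det K|%N%:R^-1.
  apply/eqP; rewrite eq_le -{2}QE ge andbT -[leRHS]mul1r ler_pdivlMr //.
  by rewrite mulrC.
by rewrite QE PE divff // gt_eqF.
Qed.

End Index.

Definition extremal_order (s : seq 'I_n.+2) : Prop :=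
  [/\ size s = n.+2, uniq s, nth p s 0 = q, nth p s n.+1 = p &
     [/\ forall i, (i < n)%N -> beta (nth p s i.+1) = (sylv i.+1)%:R^-1,
      beta p = sylv_rem n / 2 & beta q = sylv_rem n / 2]].

(** The divisibility of the edge from p to q comes from [face_index_eq], so the face must contain
    both and be based at p. For l = d this is automatic; for l = 1 the face has to be shown to be
    this very edge. *)
Lemma index_eq_extremal l (f : 'I_l.+1 -> 'I_n.+2) (K : 'M[int]_l) B :
  (3 <= n)%N -> l = 1%N \/ l = n.+1 -> injective f ->
  base_edges (v \o f) ord0 = K *m B ->
  (`|\det K| * sylv_prod (n.+1 - l) = 2 * sylv_prod n ^ 2)%N ->
  (exists s, extremal_order s) /\
  exists y, (sylv_rem n / 2) *: (ratv (v q) - ratv (v p)) = ratv y.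
Proof.
move=> n_ge3 lE f_inj KB NE.
have l_gt0 : (0 < l)%N by case: lE => ->.
have prod_eq := beta_prod_eq n_ge2 beta_gt0 beta_sum prod_sum neq_pq beta_pq beta_q.
suff [[s sE] [r [i0 [fr fi0 NP]]]] : (exists s, extremal_order s) /\
    exists r i0, [/\ f r = p, f (lift r i0) = q &
      `|\det K|%N%:R * \prod_i beta (f (lift r i)) = 1].
  split; first by exists s.
  case: (sE) => _ _ _ _ [_ bp bq].
  have := @face_index_eq _ _ v_full _ _ beta_gt0 beta_sum z0E z0_unique _ _ r _ _ f_inj KB i0 NP.
  rewrite fr fi0 bp bq => /(_ (lexx _)) [y yE].
  by exists y.
case: lE => lE.
  subst l.
  have eq_half (r : 'I_2) : p \notin [set f (lift r i) | i : 'I_1] ->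
      beta (f (lift r ord0)) = sylv_rem n / 2.
    move=> pL; have [] := index_eq_link l_gt0 f_inj KB pL NE.
    rewrite (prod_link f_inj) big_ord1 => -> _.
    by rewrite subSS subn0; field; rewrite gt_eqF // sylv_rem_gt0.
  have [r pL] := link_base f_inj.
  have fp : f (lift r ord0) != p by apply: contraNneq pL => <-; apply/imsetP; exists ord0.
  (* The endpoint found so far has this value and is not p, so it bounds [beta q] from above; the
     general estimate for the set {q} bounds it from below. *)
  have qhalf : beta q = sylv_rem n / 2.
    apply/eqP; rewrite eq_le -{1}(eq_half r pL) beta_q //=.
    have pq1 : p \notin [set q] by rewrite inE.
    have := prod_ge pq1; rewrite cards1 big_set1 => /(_ isT); apply: le_trans.
    rewrite subSS subn0 le_eqVlt; apply/orP; left; apply/eqP.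
    by field; rewrite gt_eqF // sylv_rem_gt0.
  have [s sE] : exists s, extremal_order s.
    apply: (prod_eq [set q]); rewrite ?inE ?cards1 ?big_set1 //; first by left.
    by rewrite qhalf subSS subn0; field; rewrite gt_eqF // sylv_rem_gt0.
  split; first by exists s.
  have [ss us s0 sn [bs bp bq]] := sE.
  (* All coordinates other than those of p and q are some 1/s_i >= [sylv_rem n], too large for this
     value. *)
  have half_q a : a != p -> beta a = sylv_rem n / 2 -> a = q.
    move=> ap ba; apply/eqP; apply: contraT => aq.
    have a_s : a \in s.
      have : #|s| = #|'I_n.+2| by rewrite (card_uniqP us) ss card_ord.
      by move/subset_cardP => /(_ (subset_predT _)) ->.
    have lti : (index a s < n.+2)%N by move: a_s; rewrite -index_mem ss.
    have nthi := nth_index p a_s.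
    case: (index a s) lti nthi => [|i] lti nthi; first by rewrite -nthi s0 eqxx in aq.
    have ltin : (i < n)%N.
      rewrite ltn_neqAle; apply/andP; split; last exact: lti.
      apply/eqP => iE.
      by move: nthi; rewrite iE sn => E; rewrite E eqxx in ap.
    have := bs i ltin; rewrite nthi ba.
    have V0 := sylv_rem_gt0 n; have := sylv_inv i; have := sylv_rem_gt0 i.+1.
    have s0' : 0 < (sylv i.+1)%:R^-1 :> rat by rewrite invr_gt0 ltr0n /sylv addn1.
    have Vle : sylv_rem n <= (sylv i.+1)%:R^-1.
      rewrite lef_pV2 ?posrE ?ltr0n ?sylv_prod_gt0 /sylv ?addn1 // ler_nat.
      apply: leq_trans (leq_sylv_prod ltin) => /=.
      by rewrite addn1 leq_pmull // sylv_prod_gt0.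
    lra.
  (* If neither endpoint were p, each would have the value [sylv_rem n / 2], so both would be q. *)
  have /existsP[r' /eqP fr'] : [exists r, f r == p].
    apply: contraT => /existsPn nf.
    have pL' (r' : 'I_2) : p \notin [set f (lift r' i) | i : 'I_1].
      by apply/negP => /imsetP[i _ E]; have := nf (lift r' i); rewrite E eqxx.
    have fq (r' : 'I_2) : f (lift r' ord0) = q by apply: half_q => //; exact: eq_half.
    by have := etrans (fq ord0) (esym (fq (lift ord0 ord0))) => /f_inj /(congr1 val).
  have pL' : p \notin [set f (lift r' i) | i : 'I_1].
    by apply/negP => /imsetP[i _]; rewrite -fr' => /f_inj /eqP; rewrite (negPf (neq_lift _ _)).
  have fp' : f (lift r' ord0) != p by apply: contraNneq pL' => <-; apply/imsetP; exists ord0.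
  exists r', ord0; split=> //; first by apply: half_q => //; exact: eq_half.
  by have [_] := index_eq_link l_gt0 f_inj KB pL' NE; rewrite (prod_link f_inj).
subst l.
have f_onto a : exists j, f j = a.
  by have /codomP[j ->] := inj_card_onto f_inj (leqnn _) a; exists j.
have [r fr] := f_onto p; have [j fj] := f_onto q.
have [i0 jE] : exists i0, j = lift r i0.
  case: (unliftP r j) => [i0 ->|jr]; first by exists i0.
  by move: neq_pq; rewrite -fr -fj jr eqxx.
have pL : p \notin [set f (lift r i) | i : 'I_n.+1].
  by apply/negP => /imsetP[i _]; rewrite -fr => /f_inj /eqP; rewrite (negPf (neq_lift _ _)).
have [PE NP] := index_eq_link l_gt0 f_inj KB pL NE.
split.
  apply: (prod_eq [set f (lift r i) | i : 'I_n.+1]) => //.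
  - by apply/imsetP; exists i0; rewrite // -jE.
  - by right; rewrite (card_link f_inj).
  - by rewrite (card_link f_inj).
exists r, i0; split=> //; first by rewrite -jE.
by move: NP; rewrite (prod_link f_inj).
Qed.

End OneInteriorPoint.

(** * The extremal simplex *)

(* The cofactor of s_(i+1) in s_1 ... s_n is -1 modulo s_(i+1), since every later
   term is 1 modulo s_(i+1) and the product of the earlier ones is s_(i+1) - 1. *)
Lemma sylv_cofactor n i : (i < n)%N -> exists c,
  [/\ sylv_prod n = (sylv i.+1 * c)%N, (sylv i.+1 %| c.+1)%N &
      forall k, (k < n)%N -> k != i -> (sylv k.+1 %| c)%N].
Proof.
elim: n i => // n IH i; rewrite ltnS leq_eqVlt => /orP[/eqP->|ltin].
  exists (sylv_prod n); split; first by rewrite /= mulnC.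
    by rewrite /sylv /= addn1 dvdnn.
  move=> k ltk kn; have /IH[c [-> _ _]] : (k < n)%N by lia.
  exact: dvdn_mulr.
have [c [cE cdvd call]] := IH i ltin.
exists (c * sylv n.+1)%N; split.
- by rewrite /= mulnA -cE.
- have -> : (c * sylv n.+1).+1 = (c * sylv_prod n + c.+1)%N.
    by rewrite /sylv mulnDr muln1 addnS.
  by rewrite dvdn_add // cE dvdn_mull // dvdn_mulr.
- move=> k ltk ki; have [kn|kn] := eqVneq k n; first by rewrite kn dvdn_mull.
  by rewrite dvdn_mulr // call //; lia.
Qed.

Lemma absz_prod (I : finType) (F : I -> int) : absz (\prod_i F i) = (\prod_i absz (F i))%N.
Proof. exact: (big_morph absz abszM). Qed.

Definition Sd1_size (n k : nat) : nat :=
  if (k < n)%N then sylv k.+1 else (2 * sylv_prod n)%N.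

Lemma Sd1_size_gt0 n k : (0 < Sd1_size n k)%N.
Proof. by rewrite /Sd1_size /sylv; case: ifP; rewrite ?addn1 // muln_gt0 sylv_prod_gt0. Qed.

Lemma sylv_subn1 i : (sylv i.+1 - 1 = sylv_prod i)%N.
Proof. by rewrite /sylv addnK. Qed.

Lemma Sd1_simplex0 n : Sd1_simplex n.+1 ord0 = 0.
Proof. by apply/rowP => k; rewrite !mxE. Qed.

Lemma Sd1_simplex_lift n (k : 'I_n.+1) :
  Sd1_simplex n.+1 (lift ord0 k) = (Sd1_size n k)%:Z *: delta_mx 0 k.
Proof.
apply/rowP => j; rewrite !mxE /= /bump /= add1n eqSS eq_sym.
have [->|ne] := eqVneq j k; rewrite ?mulr0 //; last first.
  by rewrite (_ : (j == k :> nat) = false) ?mulr0 //; exact: negPf.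
by rewrite eqxx mulr1 ltnS /Sd1_size sylv_subn1; case: ifP.
Qed.

Lemma Sd1_size_prod n m : (m <= n)%N ->
  (sylv_prod m * \prod_(m <= k < n.+1) Sd1_size n k = 2 * sylv_prod n ^ 2)%N.
Proof.
move=> lemn; rewrite big_nat_recr //= {2}/Sd1_size ltnn.
rewrite (eq_big_nat _ _ (F2 := fun k => sylv k.+1)) => [|k /andP[_ ltkn]]; last first.
  by rewrite /Sd1_size ltkn.
suff prodE : (sylv_prod m * \prod_(m <= k < n) sylv k.+1 = sylv_prod n)%N.
  by rewrite mulnA prodE mulnCA mulnn.
elim: n lemn => [|n IH] lemn; first by rewrite big_geq // (_ : m = 0%N) //; lia.
move: lemn; rewrite leq_eqVlt => /orP[/eqP->|lemn]; first by rewrite big_geq ?muln1.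
by rewrite big_nat_recr //= mulnA IH.
Qed.

Lemma unimod_equiv_of_vertices d (v w : 'I_d.+1 -> 'rV[int]_d) (tau : 'I_d.+1 -> 'I_d.+1)
    (F : 'M[int]_d) :
  injective tau -> F \in unitmx -> (forall i, v (tau i) = w i *m F + v (tau ord0)) ->
  unimod_equiv v w.
Proof.
move=> tau_inj Fu vE.
pose A := mxQ (invmx F); pose t : 'rV[rat]_d := - (ratv (v (tau ord0)) *m A).
have mapE z : ratv z *m A + t = ratv ((z - v (tau ord0)) *m invmx F).
  by rewrite /t -mulmxBl [RHS]mxQM; congr (_ *m _); apply/rowP => k; rewrite !mxE rmorphB.
have vertex i : ratv (v (tau i)) *m A + t = ratv (w i).
  by rewrite mapE vE addrK mulmxK.
have affine (lam : 'I_d.+1 -> rat) : \sum_i lam i = 1 ->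
    (\sum_i lam i *: ratv (v (tau i))) *m A + t = \sum_i lam i *: ratv (w i).
  move=> sum1; rewrite mulmx_suml -[t]scale1r -sum1 scaler_suml -big_split /=.
  by apply: eq_bigr => i _; rewrite -scalemxAl -scalerDr vertex.
have [tau' tauK tau'K] := injF_bij tau_inj.
have tau_bij : {on xpredT, bijective tau} by exists tau' => i _; rewrite ?tauK ?tau'K.
exists A, t; split.
  have : A *m mxQ F = 1%:M by rewrite -mxQM mulVmx // /mxQ map_scalar_mx.
  by case/mulmx1_unit.
split=> [z|]; first by exists ((z - v (tau ord0)) *m invmx F).
split=> [z'|].
  by exists (z' *m F + v (tau ord0)); rewrite mapE addrK mulmxK.
split=> [x [lam [lam0 [sum1 ->]]]|y [mu [mu0 [sum1 ->]]]].
  have sum1' : \sum_i lam (tau i) = 1 by rewrite -sum1 [RHS](reindex tau).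
  exists (lam \o tau); split=> [i|]; first exact: lam0.
  split; first exact: sum1'.
  by rewrite -affine // (reindex tau) //=.
exists (\sum_i mu i *: ratv (v (tau i))); split; last exact: affine.
exists (mu \o tau'); split=> [i|]; first exact: mu0.
split; first by rewrite -sum1 (reindex tau) //=; apply: eq_bigr => i _; rewrite /= tauK.
by rewrite [RHS](reindex tau) //=; apply: eq_bigr => i _; rewrite tauK.
Qed.

Section Extremal.
Variables (n : nat) (v : 'I_n.+2 -> 'rV[int]_n.+1).
Variables (beta : 'I_n.+2 -> rat) (z0 : 'rV[int]_n.+1) (p q : 'I_n.+2).
Hypotheses (n_ge2 : (2 <= n)%N) (v_full : full_dim v).
Hypotheses (beta_gt0 : forall i, 0 < beta i) (beta_sum : \sum_i beta i = 1).
Hypothesis z0E : ratv z0 = \sum_i beta i *: ratv (v i).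
Hypothesis z0_unique : forall z, in_interior v (ratv z) -> z = z0.
Hypotheses (neq_pq : p != q) (beta_pq : beta p <= beta q).
Hypothesis beta_q : forall i, i != p -> beta q <= beta i.

(** With e_k the edges at q, z0 - v q is the sum of the e_k / m_k. Multiplied by the cofactor c of
    s_(k+1), all terms but the k-th become integral, so c e_k / m_k is integral; since m_k divides c
    + 1, so is e_k / m_k. The last edge is divisible by hypothesis. *)
Lemma extremal_unimod s y : extremal_order beta p q s ->
  (sylv_rem n / 2) *: (ratv (v q) - ratv (v p)) = ratv y ->
  unimod_equiv v (Sd1_simplex n.+1).
Proof.
case=> ss us s0 sn [bs bp bq] yE.
pose tau (i : 'I_n.+2) := nth p s i.
have tau_inj : injective tau.
  by move=> i j /eqP; rewrite nth_uniq ?ss ?ltn_ord // => /eqP/val_inj.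
pose e (k : 'I_n.+1) : 'rV[rat]_n.+1 := ratv (v (tau (lift ord0 k))) - ratv (v q).
pose m (k : 'I_n.+1) : rat := (Sd1_size n k)%:R.
have m0 k : m k != 0 by rewrite pnatr_eq0 -lt0n Sd1_size_gt0.
have beta_tau k : beta (tau (lift ord0 k)) = (m k)^-1.
  rewrite /tau /m /Sd1_size lift0; case: ltnP => [ltk|gek]; first exact: bs.
  have -> : k.+1 = n.+1 by congr _.+1; apply/eqP; rewrite eqn_leq gek -ltnS ltn_ord.
  by rewrite sn bp /sylv_rem natrM invfM mulrC.
have tau0 : tau ord0 = q by [].
have [tau' tauK tau'K] := injF_bij tau_inj.
have tau_bij : {on xpredT, bijective tau} by exists tau' => i _; rewrite ?tauK ?tau'K.
have z0e : ratv (z0 - v q) = \sum_k (m k)^-1 *: e k.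
  have -> : ratv (z0 - v q) = ratv z0 - ratv (v q).
    by apply/rowP => k; rewrite !mxE rmorphB.
  have -> : ratv (v q) = \sum_i beta i *: ratv (v q) by rewrite -scaler_suml beta_sum scale1r.
  rewrite z0E -sumrB (reindex tau) //= (bigD1_ord ord0) //= tau0 subrr add0r.
  by apply: eq_bigr => k _; rewrite -scalerBr beta_tau.
pose integral (x : 'rV[rat]_n.+1) := exists z, x = ratv z.
have int_e k : integral (e k).
  by exists (v (tau (lift ord0 k)) - v q); apply/rowP => j; rewrite !mxE rmorphB.
have int0 : integral 0 by exists 0; apply/rowP => j; rewrite !mxE.
have intD x x' : integral x -> integral x' -> integral (x + x').
  by move=> [z ->] [z' ->]; exists (z + z'); apply/rowP => j; rewrite !mxE rmorphD.
have intB x x' : integral x -> integral x' -> integral (x - x').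
  by move=> [z ->] [z' ->]; exists (z - z'); apply/rowP => j; rewrite !mxE rmorphB.
have intZ (c : nat) x : integral x -> integral (c%:R *: x).
  by move=> [z ->]; exists (c%:Z *: z); apply/rowP => j; rewrite !mxE rmorphM.
have last_e : integral ((m ord_max)^-1 *: e ord_max).
  exists (- y); rewrite /m /Sd1_size /= ltnn.
  have -> : ratv (- y) = - ratv y by apply/rowP => j; rewrite !mxE rmorphN.
  rewrite -yE -scalerN opprB /e; congr (_ *: (ratv (v _) - _)); last by rewrite /tau lift0.
  by rewrite natrM invfM mulrC.
have all_e k : integral ((m k)^-1 *: e k).
  have [ltkn|] := ltnP k n; last first.
    move=> gek; have -> // : k = ord_max by apply/val_inj/eqP; rewrite eqn_leq /= gek -ltnS ltn_ord.
  have [c [cE /dvdnP[a aE] call]] := sylv_cofactor ltkn.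
  have mk : m k = (sylv k.+1)%:R by rewrite /m /Sd1_size ltkn.
  have c_e : integral ((c%:R / m k) *: e k).
    have -> : (c%:R / m k) *: e k =
        c%:R *: ratv (z0 - v q) - \sum_(j | j != k) c%:R *: ((m j)^-1 *: e j).
      by rewrite z0e scaler_sumr (bigD1 k) //= addrK scalerA.
    apply: intB; first by apply: intZ; exists (z0 - v q).
    apply: (big_ind integral) => // j jk.
    have [ltjn|] := ltnP j n; last first.
      move=> gej; have -> : j = ord_max by apply/val_inj/eqP; rewrite eqn_leq /= gej -ltnS ltn_ord.
      exact: intZ.
    have /dvdnP[b ->] := call j ltjn jk.
    have mj : m j = (sylv j.+1)%:R by rewrite /m /Sd1_size ltjn.
    by rewrite natrM -mj scalerA mulfK //; exact: intZ.
  have -> : (m k)^-1 *: e k = a%:R *: e k - (c%:R / m k) *: e k.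
    rewrite -scalerBl; congr (_ *: _); apply: (mulIf (m0 k)).
    by rewrite mulVf // mulrBl divfK // mk -natrM -aE -natr1 addrC addKr.
  exact: intB (intZ _ _ _) _.
have [F FE] := fin_all_exists all_e.
pose FM := \matrix_k F k.
have edges : base_edges (v \o tau) ord0 = diag_mx (\row_k (Sd1_size n k)%:Z) *m FM.
  apply: mxQ_inj; apply/row_matrixP => k; rewrite mxQM.
  have -> : mxQ (diag_mx (\row_k (Sd1_size n k)%:Z)) = diag_mx (\row_k m k).
    apply/matrixP => i j; rewrite !mxE; case: eqP => _; rewrite ?mulr1n ?mulr0n //.
  rewrite row_mul row_diag_mx -scalemxAl mxE -rowE.
  have -> : row k (mxQ FM) = (m k)^-1 *: e k by rewrite FE; apply/rowP => j; rewrite !mxE.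
  by rewrite scalerA divff // scale1r; apply/rowP => j; rewrite !mxE rmorphB /= tau0.
(* The divisors already multiply to the largest index allowed for l = d, so the remaining factor
   |det FM| is at most 1. *)
have FMu : FM \in unitmx.
  have := index_bound n_ge2 v_full beta_gt0 beta_sum z0E z0_unique neq_pq beta_pq beta_q
    (ltn0Sn n) tau_inj (esym (mulmx1 _)).
  rewrite subnn muln1 edges det_mulmx abszM det_diag.
  have -> : absz (\prod_i (\row_(k < n.+1) (Sd1_size n k)%:Z) 0 i) = (2 * sylv_prod n ^ 2)%N.
    rewrite -(Sd1_size_prod (leq0n n)) mul1n big_mkord.
    by rewrite absz_prod; apply: eq_bigr => i _; rewrite mxE.
  rewrite -{2}(muln1 (2 * _)%N) leq_pmul2l ?muln_gt0 ?expn_gt0 ?sylv_prod_gt0 // => le1.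
  have := base_edges_free v_full ord0 tau_inj.
  rewrite row_free_unit unitmxE det_mxQ edges det_mulmx unitfE intr_eq0 mulf_eq0 negb_or.
  case/andP=> _; rewrite unitmxE -absz_eq0; case: (\det FM) le1 => -[|[|]] //.
apply: (unimod_equiv_of_vertices tau_inj FMu) => i.
case: (unliftP ord0 i) => [k ->|->]; last by rewrite Sd1_simplex0 mul0mx add0r.
rewrite Sd1_simplex_lift -scalemxAl -rowE rowK; apply/rowP => j.
have /rowP/(_ j) := FE k; rewrite !mxE => E.
apply: (intr_inj (R := rat)); rewrite rmorphD rmorphM /= -E tau0.
by rewrite -pmulrn -/(m k) mulrA divff // mul1r subrK.
Qed.

End Extremal.

(** * Faces of unimodular images of the extremal simplex *)

(** The rows of [B1] lie in the span of the edges, hence in the lattice generated by [B]. Any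
    explicit factorisation of the edges thus bounds the index from below. *)
Lemma lattice_index_dvd d l (E B B1 : 'M[int]_(l, d)) (K K1 : 'M[int]_l) :
  row_free (mxQ E) -> is_lattice_basis E B -> E = K *m B -> E = K1 *m B1 ->
  (`|\det K1| %| `|\det K|)%N.
Proof.
move=> Efree Bbasis EK EK1.
have [_ Bfree] : row_free (mxQ K) /\ row_free (mxQ B).
  by apply: row_free_mulmx; rewrite -mxQM -EK.
have [K1free _] : row_free (mxQ K1) /\ row_free (mxQ B1).
  by apply: row_free_mulmx; rewrite -mxQM -EK1.
have /fin_all_exists[k kE] i : exists k : 'rV[int]_l, row i B1 = k *m B.
  apply/Bbasis; exists (delta_mx 0 i *m invmx (mxQ K1)).
  rewrite EK1 mxQM mulmxA mulmxKV -?row_free_unit // -rowE.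
  by apply/rowP => j; rewrite !mxE.
have B1E : B1 = (\matrix_i k i) *m B by apply/row_matrixP => i; rewrite row_mul rowK kE.
have KE : K = K1 *m \matrix_i k i.
  apply: mxQ_inj; apply: (row_free_inj Bfree).
  by rewrite -!mxQM -EK EK1 B1E mulmxA.
by rewrite KE det_mulmx abszM dvdn_mulr.
Qed.

Lemma base_edges_Sd1 n :
  base_edges (Sd1_simplex n.+1) ord0 = diag_mx (\row_k (Sd1_size n k)%:Z).
Proof.
apply/matrixP => i j; rewrite [LHS]mxE Sd1_simplex_lift Sd1_simplex0 !mxE eqxx subr0.
by rewrite [j == i]eq_sym; case: (i == j); rewrite ?mulr1 ?mulr0.
Qed.

Lemma full_dim_Sd1 n : full_dim (Sd1_simplex n.+1).
Proof.
rewrite /full_dim full_simplex_edgesE base_edges_Sd1 det_mxQ intr_eq0 det_diag.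
by apply/prodf_neq0 => i _; rewrite mxE -lt0n Sd1_size_gt0.
Qed.

Lemma bary_eq d (w : 'I_d.+1 -> 'rV[int]_d) (lam mu : 'I_d.+1 -> rat) : full_dim w ->
  \sum_i lam i = \sum_i mu i ->
  \sum_i lam i *: ratv (w i) = \sum_i mu i *: ratv (w i) -> lam =1 mu.
Proof.
move=> w_full eqs eqc i; apply/eqP; rewrite -subr_eq0; apply/eqP.
apply: (bary_unique w_full (c := fun i => lam i - mu i)); first by rewrite sumrB eqs subrr.
by under eq_bigr do rewrite scalerBl; rewrite sumrB eqc subrr.
Qed.

Lemma sum_delta d (k : 'I_d) : \sum_i (i == k)%:R = 1 :> rat.
Proof. by rewrite (bigD1 k) //= eqxx big1 ?addr0 // => i /negPf->. Qed.

Lemma comb_delta d (w : 'I_d.+1 -> 'rV[int]_d) k :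
  \sum_i (i == k)%:R *: ratv (w i) = ratv (w k).
Proof.
rewrite (bigD1 k) //= eqxx scale1r big1 ?addr0 // => i /negPf->.
by rewrite scale0r.
Qed.

(* The preimage of a vertex is a convex combination of points of conv v, so by
   extremality it is a vertex of conv v. *)
Lemma unimod_equiv_vertices d (v w : 'I_d.+1 -> 'rV[int]_d) (A : 'M[rat]_d) t :
  full_dim w -> (forall x, in_conv v x -> in_conv w (x *m A + t)) ->
  (forall y, in_conv w y -> exists x, in_conv v x /\ x *m A + t = y) ->
  forall k, exists i, ratv (v i) *m A + t = ratv (w k).
Proof.
move=> w_full vw wv k.
have [x [[lam [lam0 [sum1 xE]]] xk]] : exists x, in_conv v x /\ x *m A + t = ratv (w k).
  apply: wv; exists (fun i => (i == k)%:R); split=> [i|]; first by rewrite ler0n.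
  by rewrite sum_delta comb_delta.
have /fin_all_exists[mu muE] i : exists mu : 'I_d.+1 -> rat,
    (forall a, 0 <= mu a) /\ \sum_a mu a = 1 /\
    ratv (v i) *m A + t = \sum_a mu a *: ratv (w a).
  apply: vw; exists (fun a => (a == i)%:R); split=> [a|]; first by rewrite ler0n.
  by rewrite sum_delta comb_delta.
have combE : \sum_a (\sum_i lam i * mu i a) *: ratv (w a) = ratv (w k).
  rewrite -xk xE mulmx_suml -[t]scale1r -sum1 scaler_suml -big_split /=.
  under eq_bigr do rewrite scaler_suml.
  rewrite exchange_big /=; apply: eq_bigr => i _.
  case: (muE i) => _ [_ muC]; rewrite -scalemxAl -scalerDr muC scaler_sumr.
  by apply: eq_bigr => a _; rewrite scalerA.
have lam_mu a : \sum_i lam i * mu i a = (a == k)%:R.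
  apply: (@bary_eq _ w (fun a => \sum_i lam i * mu i a) (fun a => (a == k)%:R)) => //; last first.
    by rewrite combE comb_delta.
  rewrite sum_delta exchange_big /= -[RHS]sum1; apply: eq_bigr => i _.
  by case: (muE i) => _ [s1 _]; rewrite -mulr_sumr s1 mulr1.
have [i lami] : exists i, lam i != 0.
  apply/existsP; apply: contraT => /existsPn lam_0.
  move: sum1; rewrite big1 => [/esym/eqP|i _]; first by rewrite oner_eq0.
  by have := lam_0 i; rewrite negbK => /eqP.
exists i; case: (muE i) => mui0 [mui1 ->].
have mu_out a : a != k -> mu i a = 0.
  move=> ak; have := lam_mu a; rewrite (negPf ak) => /eqP.
  rewrite psumr_eq0 => [|j _]; last by case: (muE j) => muj0 _; rewrite mulr_ge0.
  by move=> /allP/(_ i (mem_index_enum _)); rewrite mulf_eq0 (negPf lami) => /eqP.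
rewrite -comb_delta; apply: eq_bigr => a _; congr (_ *: _).
have [->|/mu_out//] := eqVneq a k.
by move: mui1; rewrite (bigD1 k) //= big1 ?addr0.
Qed.

Section FaceEnumeration.
Variables (d l : nat) (I : {set 'I_d.+1}).
Hypothesis cardI : #|I| = l.+1.

Definition face_enum (j : 'I_l.+1) : 'I_d.+1 := nth ord0 (enum I) j.

Lemma face_enum_inj : injective face_enum.
Proof.
move=> i j /eqP; rewrite nth_uniq ?enum_uniq -?cardE ?cardI ?ltn_ord //.
by move/eqP/val_inj.
Qed.

Lemma mem_face_enum j : face_enum j \in I.
Proof. by rewrite -mem_enum mem_nth // -cardE cardI. Qed.

Lemma face_edgesE (v : 'I_d.+1 -> 'rV[int]_d) :
  edge_mx l (face_vertices v I) = base_edges (v \o face_enum) ord0.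
Proof. by apply/matrixP => i k; rewrite !mxE. Qed.

End FaceEnumeration.

Lemma unimod_Sd1_face n (v : 'I_n.+2 -> 'rV[int]_n.+1) l :
  unimod_equiv v (Sd1_simplex n.+1) -> (1 <= l <= n.+1)%N ->
  exists2 I : {set 'I_n.+2}, #|I| = l.+1 &
    exists (K : 'M[int]_l) B,
      edge_mx l (face_vertices v I) = K *m B /\
      (\prod_(n.+1 - l <= k < n.+1) Sd1_size n k %| `|\det K|)%N.
Proof.
move=> [A [t [Au [_ [int_onto [vw wv]]]]]] /andP[l_gt0 le_l].
set w := Sd1_simplex n.+1 in vw wv *.
have /fin_all_exists[g gE] := unimod_equiv_vertices (full_dim_Sd1 n) vw wv.
have g_inj : injective g.
  move=> k k' eqg; have eqw : ratv (w k) = ratv (w k') by rewrite -!gE eqg.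
  have := @bary_eq _ w (fun i => (i == k)%:R) (fun i => (i == k')%:R) (full_dim_Sd1 n).
  rewrite !sum_delta !comb_delta => /(_ erefl eqw k)/eqP.
  by rewrite eqxx eqr_nat eq_sym eqb1 => /eqP.
pose m := (n.+1 - l)%N.
(* The face is spanned by the origin and the last l vertices, which carry the longest edges. *)
pose h (j : 'I_l.+1) : 'I_n.+2 := inord (if val j == 0%N then 0%N else (m + j)%N).
have h0 : h ord0 = ord0 by apply: val_inj; rewrite /= inordK.
pose c (i : 'I_l) : 'I_n.+1 := inord (m + i).
have cE i : c i = (m + i)%N :> nat.
  by rewrite inordK //; have := ltn_ord i; rewrite /m; lia.
have h_lift i : h (lift ord0 i) = lift ord0 (c i).
  apply: ord_inj; rewrite [RHS]lift0 cE /h -[val _]/(nat_of_ord _) !lift0 /= addnS inordK //.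
  by have := ltn_ord i; rewrite /= /m; lia.
have h_inj : injective h.
  move=> i j; case: (unliftP ord0 i) => [i' ->|->]; case: (unliftP ord0 j) => [j' ->|->] //.
  - rewrite !h_lift => /lift_inj /(congr1 val) /=; rewrite !cE => /addnI/val_inj -> //.
  - by rewrite h0 h_lift => /eqP; rewrite eq_sym (negPf (neq_lift _ _)).
  - by rewrite h0 h_lift => /eqP; rewrite (negPf (neq_lift _ _)).
pose I := [set g (h j) | j : 'I_l.+1].
have cardI : #|I| = l.+1 by rewrite card_imset ?card_ord // => i j /g_inj/h_inj.
exists I => //.
pose P : 'M[int]_(l, n.+1) := \matrix_i delta_mx 0 (c i).
pose D : 'M[int]_l := diag_mx (\row_i (Sd1_size n (m + i)%N)%:Z).
have coord j : exists k : 'rV[int]_l, w (h j) = k *m (D *m P).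
  case: (unliftP ord0 j) => [i ->|->]; last by exists 0; rewrite mul0mx h0 /w Sd1_simplex0.
  exists (delta_mx 0 i); rewrite h_lift /w Sd1_simplex_lift -rowE row_mul row_diag_mx.
  by rewrite -scalemxAl -rowE rowK mxE cE.
(* Subtracting a preimage of 0 cancels the translation [t]. *)
have /fin_all_exists[b bE] i : exists b : 'rV[int]_n.+1, ratv b *m A = ratv (row i P).
  have [z1 z1E] := int_onto (row i P); have [z2 z2E] := int_onto 0.
  exists (z1 - z2).
  have -> : ratv (z1 - z2) = ratv z1 - ratv z2 by apply/rowP => k; rewrite !mxE rmorphB.
  have -> : ratv (row i P) = ratv (row i P) - ratv 0.
    by apply/rowP => k; rewrite !mxE subr0.
  by rewrite -z1E -z2E mulmxBl opprD addrACA subrr addr0.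
pose B := \matrix_i b i.
have BA : mxQ B *m A = mxQ P.
  apply/row_matrixP => i; rewrite row_mul.
  have -> : row i (mxQ B) = ratv (b i) by apply/rowP => k; rewrite !mxE.
  by rewrite bE; apply/rowP => k; rewrite !mxE.
(* The enumeration of I need not follow [h], so its first vertex may not correspond to the origin;
   edges are therefore written as differences of two coordinate vectors. *)
have /fin_all_exists[kap kapE] (j : 'I_l.+1) : exists k : 'rV[int]_l,
    ratv (v (face_enum I j)) *m A + t = ratv (k *m (D *m P)).
  have /imsetP[j' _ ->] := mem_face_enum cardI j.
  by have [k kE] := coord j'; exists k; rewrite gE -/w kE.
pose K := \matrix_i (kap (lift ord0 i) - kap ord0).
exists (K *m D), B; split; last first.
  have -> : (\prod_(n.+1 - l <= k < n.+1) Sd1_size n k = `|\det D|)%N.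
    rewrite det_diag absz_prod -big_ord_shift subKn //.
    by apply: eq_bigr => i _; rewrite mxE addnC.
  by rewrite det_mulmx abszM dvdn_mull.
rewrite face_edgesE -mulmxA; apply: mxQ_inj.
have Afree : row_free A by rewrite row_free_unit.
apply: (row_free_inj Afree).
rewrite [mxQ (K *m _)]mxQM [mxQ (D *m _)]mxQM -!mulmxA BA -!mxQM.
apply/row_matrixP => i; rewrite row_mul.
have -> : row i (mxQ (base_edges (v \o face_enum I) ord0)) =
    ratv (v (face_enum I (lift ord0 i))) - ratv (v (face_enum I (ord0 : 'I_l.+1))).
  by apply/rowP => k; rewrite !mxE rmorphB.
have subK (x y : 'rV[rat]_n.+1) : x - y = (x + t) - (y + t).
  by rewrite opprD addrACA subrr addr0.
rewrite mulmxBl subK !kapE.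
have -> : ratv (kap (lift ord0 i) *m (D *m P)) - ratv (kap ord0 *m (D *m P)) =
    ratv ((kap (lift ord0 i) - kap ord0) *m (D *m P)).
  by rewrite mulmxBl; move: (_ *m _) (_ *m _) => x y; apply/rowP => k; rewrite !mxE rmorphB.
have -> : kap (lift ord0 i) - kap ord0 = row i K by rewrite rowK.
by rewrite -row_mul; apply/rowP => k; rewrite !mxE.
Qed.

(** * From lattice indices back to volumes *)

Lemma vol_boundE n l :
  vol_bound n.+1 l * (l`!)%:R = (2 * sylv_prod n ^ 2)%N%:R / (sylv_prod (n.+1 - l))%:R.
Proof.
rewrite /vol_bound addn1 !sylv_subn1 invfM mulrA mulrAC divfK //.
by rewrite pnatr_eq0 -lt0n fact_gt0.
Qed.

Lemma vol_bound_le n l N :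
  (N%:R / (l`!)%:R <= vol_bound n.+1 l) = (N * sylv_prod (n.+1 - l) <= 2 * sylv_prod n ^ 2)%N.
Proof.
rewrite ler_pdivrMr ?ltr0n ?fact_gt0 // vol_boundE ler_pdivlMr ?ltr0n ?sylv_prod_gt0 //.
by rewrite -natrM ler_nat.
Qed.

Lemma vol_bound_eq n l N :
  N%:R / (l`!)%:R = vol_bound n.+1 l <->
  (N * sylv_prod (n.+1 - l) = 2 * sylv_prod n ^ 2)%N.
Proof.
have f0 : (l`!)%:R != 0 :> algC by rewrite pnatr_eq0 -lt0n fact_gt0.
have s0 : (sylv_prod (n.+1 - l))%:R != 0 :> algC by rewrite pnatr_eq0 -lt0n sylv_prod_gt0.
split=> [E|/(congr1 (fun k => k%:R : algC)) E].
  apply/eqP; rewrite -(eqr_nat algC) natrM; apply/eqP.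
  by rewrite -[RHS](divfK s0) -vol_boundE -E divfK.
by apply: (mulIf f0); rewrite divfK // vol_boundE -E natrM mulfK.
Qed.

Section Main.
Variables (n : nat) (v : 'I_n.+2 -> 'rV[int]_n.+1).
Hypotheses (n_ge2 : (2 <= n)%N) (v_Sd1 : in_Sd1 v).

Let v_full : full_dim v. Proof. by case: v_Sd1. Qed.

Lemma simplex_index_bound l (f : 'I_l.+1 -> 'I_n.+2) (K : 'M[int]_l) B : (0 < l)%N ->
  injective f -> base_edges (v \o f) ord0 = K *m B ->
  (`|\det K| * sylv_prod (n.+1 - l) <= 2 * sylv_prod n ^ 2)%N.
Proof.
have [_ [z0 [[beta [beta0 [beta1 z0E]]] z0u]]] := v_Sd1.
have [p [q [pq bpq bq]]] := two_smallest beta.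
have z0u' z : in_interior v (ratv z) -> z = z0 by move/z0u.
exact: (index_bound n_ge2 v_full beta0 beta1 z0E z0u' pq bpq bq).
Qed.

Lemma simplex_index_eq l (f : 'I_l.+1 -> 'I_n.+2) (K : 'M[int]_l) B :
  (3 <= n)%N -> l = 1%N \/ l = n.+1 ->
  injective f -> base_edges (v \o f) ord0 = K *m B ->
  (`|\det K| * sylv_prod (n.+1 - l) = 2 * sylv_prod n ^ 2)%N ->
  unimod_equiv v (Sd1_simplex n.+1).
Proof.
move=> n_ge3 lE f_inj KB NE.
have [_ [z0 [[beta [beta0 [beta1 z0E]]] z0u]]] := v_Sd1.
have [p [q [pq bpq bq]]] := two_smallest beta.
have z0u' z : in_interior v (ratv z) -> z = z0 by move/z0u.
have [[s sE] [y yE]] := index_eq_extremal n_ge2 v_full beta0 beta1 z0E z0u' pq bpq bq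
  n_ge3 lE f_inj KB NE.
exact: (extremal_unimod n_ge2 v_full beta0 beta1 z0E z0u' pq bpq bq sE yE).
Qed.

Lemma face_volZ_index l (I : {set 'I_n.+2}) : #|I| = l.+1 ->
  exists (K : 'M[int]_l) (B : 'M[int]_(l, n.+1)),
    [/\ is_lattice_basis (edge_mx l (face_vertices v I)) B,
        base_edges (v \o face_enum I) ord0 = K *m B &
        face_volZ l v I = `|\det K|%N%:R / (l`!)%:R].
Proof.
move=> cardI; rewrite -face_edgesE; apply: volZ_index.
rewrite face_edgesE; apply: base_edges_free => //; exact: face_enum_inj.
Qed.

Lemma face_volZ_le l (I : {set 'I_n.+2}) : (0 < l)%N -> #|I| = l.+1 ->
  face_volZ l v I <= vol_bound n.+1 l.
Proof.
move=> l_gt0 cardI; have [K [B [_ KB ->]]] := face_volZ_index cardI.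
by rewrite vol_bound_le; apply: simplex_index_bound KB => //; exact: face_enum_inj.
Qed.

(** The edge lengths of the chosen face bound its index from below by divisibility, and the general
    estimate bounds it from above by the same number. *)
Lemma unimod_face_volZ l : unimod_equiv v (Sd1_simplex n.+1) -> (1 <= l <= n.+1)%N ->
  exists I : {set 'I_n.+2}, #|I| = l.+1 /\ face_volZ l v I = vol_bound n.+1 l.
Proof.
move=> equiv le_l; have [I cardI [K1 [B1 [E1 dvdK1]]]] := unimod_Sd1_face equiv le_l.
case/andP: le_l => l_gt0 le_l.
exists I; split=> //; have [K [B [Bbasis KB ->]]] := face_volZ_index cardI.
have f_inj := face_enum_inj cardI.
have Efree := base_edges_free v_full ord0 f_inj.
have dvdK : (\prod_(n.+1 - l <= k < n.+1) Sd1_size n k %| `|\det K|)%N.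
  apply: dvdn_trans dvdK1 _; move: Bbasis E1; rewrite face_edgesE => Bbasis E1.
  exact: lattice_index_dvd Efree Bbasis KB E1.
have K0 : (0 < `|\det K|)%N.
  have [] : row_free (mxQ K) /\ row_free (mxQ B).
    by apply: row_free_mulmx; rewrite -mxQM -KB.
  by rewrite row_free_unit unitmxE det_mxQ unitfE intr_eq0 absz_gt0.
apply/vol_bound_eq/eqP; rewrite eqn_leq (simplex_index_bound l_gt0 f_inj KB) /=.
have le_m : (n.+1 - l <= n)%N by lia.
by rewrite -(Sd1_size_prod le_m) mulnC leq_mul2r (dvdn_leq K0 dvdK) orbT.
Qed.

Lemma face_volZ_eq l (I : {set 'I_n.+2}) : (3 <= n)%N -> l = 1%N \/ l = n.+1 ->
  #|I| = l.+1 -> face_volZ l v I = vol_bound n.+1 l ->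
  unimod_equiv v (Sd1_simplex n.+1).
Proof.
move=> n_ge3 lE cardI; have [K [B [_ KB ->]]] := face_volZ_index cardI.
by move/vol_bound_eq; apply: simplex_index_eq KB => //; exact: face_enum_inj.
Qed.

(** The index bound applies with the identity as [B], the edge matrix itself being the index matrix
    of the whole simplex. *)
Lemma euclid_vol_le :
  euclid_vol (full_simplex_edges v) <= (2%:R / (n.+1`!)%:R) * ((sylv n.+1 - 1) ^ 2)%N%:R.
Proof.
have KB := esym (mulmx1 (full_simplex_edges v)).
rewrite /euclid_vol {1 2}KB sqrtC_gramM.
have -> : sqrtC (\det (mxC (1%:M : 'M[int]_n.+1) *m (mxC 1%:M)^T)) = 1.
  by rewrite mxC_gram trmx1 mulmx1 det1 sqrtC1.
rewrite mulr1 sylv_subn1 mulrAC -natrM ler_pM2r ?invr_gt0 ?ltr0n ?fact_gt0 // ler_nat.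
rewrite full_simplex_edgesE in KB *.
have := @simplex_index_bound _ id (base_edges v ord0) 1%:M (ltn0Sn n) (@inj_id _) KB.
by rewrite subnn muln1.
Qed.

End Main.

Theorem mainTheorem2 (d : nat) (v : 'I_d.+1 -> 'rV[int]_d) :
  (3 <= d)%N -> in_Sd1 v ->
  (forall l : nat, (1 <= l <= d)%N -> forall I : {set 'I_d.+1},
      #|I| = l.+1 -> (face_volZ l v I <= vol_bound d l)%R)
  /\ (unimod_equiv v (Sd1_simplex d) ->
      forall l : nat, (1 <= l <= d)%N ->
        exists I : {set 'I_d.+1}, #|I| = l.+1 /\ face_volZ l v I = vol_bound d l)
  /\ ((4 <= d)%N -> forall l : nat, (l = 1%N \/ l = d) ->
      ((exists I : {set 'I_d.+1}, #|I| = l.+1 /\ face_volZ l v I = vol_bound d l)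
       <-> unimod_equiv v (Sd1_simplex d)))
  /\ (euclid_vol (full_simplex_edges v)
        <= (2%:R / (d`!)%:R) * ((sylv d - 1) ^ 2)%N%:R)%R.
Proof.
case: d v => // n v n_ge2 v_Sd1; split=> [l /andP[l_gt0 _] I cardI|].
  exact: face_volZ_le.
split=> [equiv l le_l|]; first exact: unimod_face_volZ.
split=> [n_ge3 l lE|]; last exact: euclid_vol_le.
split=> [[I [cardI volI]]|equiv]; first exact: face_volZ_eq volI.
by apply: unimod_face_volZ => //; case: lE => ->; rewrite ?leqnn.
Qed.
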